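(* Let $d\in(0,\frac12)$, let $L^d$ be a fractional L\'evy process, and let $\lambda>0$. Let $-\infty\le a<\infty$. Then almost surely, for $t>a$, the integral $\int_a^t e^{\lambda s}\,dL^d_s$ exists as a (for $a=-\infty$ improper) Riemann--Stieltjes integral and is equal to $$e^{\lambda t}L^d_t-e^{\lambda a}L^d_a-\lambda\int_a^tL^d_s e^{\lambda s}\,ds,$$ where for $a=-\infty$ the term $e^{\lambda a}L^d_a$ is understood as $\lim_{a\to-\infty}e^{\lambda a}L^d_a=0$. Furthermore, the function $(a,\infty)\to\mathbb R$, $t\mapsto\int_a^te^{\lambda s}\,dL^d_s$, is continuous.
   Context: All random objects live on a complete probability space $(\Omega,\mathcal F,P)$. A two-sided L\'evy process is $L_t=L^1_t1_{\{t\ge0\}}+L^2_{-t-}1_{\{t<0\}}$, $t\in\mathbb R$, where $L^1,L^2$ are two independent copies of the same L\'evy process. Fractional L\'evy process (FLP): let $L=(L_t)_{t\in\mathbb R}$ be a zero-mean two-sided L\'evy process with $E[L(1)^2]<\infty$ and without Brownian component, and $d\in(0,\frac12)$; the FLP with driving L\'evy process $L$ is $$L^d_t:=\frac{1}{\Gamma(d+1)}\int_{-\infty}^\infty[(t-s)_+^d-(-s)_+^d]\,L(ds),\quad t\in\mathbb R,$$ where the integral exists in the $L^2(\Omega)$-sense. One always works with the modification given by the pathwise improper Riemann integral $$L^d_t=\frac{1}{\Gamma(d)}\int_{\mathbb R}[(t-s)_+^{d-1}-(-s)_+^{d-1}]\,L(s)\,ds,\quad t\in\mathbb R,$$ which is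 continuous in $t$. Integrals with respect to $L^d$ are pathwise Riemann--Stieltjes integrals (limits of Riemann--Stieltjes sums as the mesh tends to zero); an improper integral over $(-\infty,t]$ is the limit of the integrals over $[R,t]$ as $R\to-\infty$. *)

(* Defs.v *)
From HB Require Import structures.
From mathcomp Require Import all_boot all_order all_algebra.
From mathcomp Require Import complex.
From mathcomp Require Import all_classical all_reals all_analysis.

Set Implicit Arguments.
Unset Strict Implicit.
Unset Printing Implicit Defensive.

Import Order.TTheory GRing.Theory Num.Theory.
Import numFieldNormedType.Exports.

Local Open Scope classical_set_scope.
Local Open Scope ring_scope.

Section riemann_stieltjes.
Context {R : realType}.
Implicit Types (f g : R -> R) (s : seq R) (xi : nat -> R).

(* A partition of [u, v] is given, as for [itv_partition], by its left endpoint
   u and the sequence s of its other points, so its i-th cell is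
   [(u :: s)`_i, s`_i] for i < size s. *)
Definition mesh_lt u s (delta : R) :=
  forall i, (i < size s)%N -> s`_i - (u :: s)`_i < delta.

Definition tags u s xi :=
  forall i, (i < size s)%N -> (u :: s)`_i <= xi i <= s`_i.

Definition RS_sum f g u s xi : R :=
  \sum_(i < size s) f (xi i) * (g s`_i - g (u :: s)`_i).

(* The condition u <= v is needed: otherwise [u, v] has no partition and every
   I would qualify. *)
Definition is_RS f g (u v I : R) := u <= v /\
  forall eps : R, 0 < eps -> exists2 delta : R, 0 < delta &
    forall s xi, itv_partition u v s -> mesh_lt u s delta -> tags u s xi ->
      `| RS_sum f g u s xi - I | < eps.

Definition proper_RS f g (u v : R) : R := xget 0 [set I | is_RS f g u v I].

(* Integral of f dg over [a, t] for a real, and over (-oo, t] (improper) for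
   a = -oo. *)
Definition is_RS_from f g (a : \bar R) (t I : R) : Prop :=
  match a with
  | u%:E => is_RS f g u t I
  | -oo%E => (forall u, u <= t -> exists J, is_RS f g u t J) /\
             proper_RS f g u t @[u --> -oo] --> I
  | +oo%E => False
  end.

Definition RS_integrable f g (a : \bar R) (t : R) :=
  exists I, is_RS_from f g a t I.

Definition RS_integral f g (a : \bar R) (t : R) : R :=
  xget 0 [set I | is_RS_from f g a t I].

(* Improper Riemann integral over an open interval (p, q), both endpoints
   being possibly singular or infinite. *)
Definition from_right (p : \bar R) : set_system R :=
  match p with
  | u%:E => u^'+
  | -oo%E => ninfty_nbhs R
  | +oo%E => pinfty_nbhs R
  end.

Definition from_left (q : \bar R) : set_system R :=
  match q with
  | v%:E => v^'-
  | -oo%E => ninfty_nbhs R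
  | +oo%E => pinfty_nbhs R
  end.

Definition is_improper_Riemann f (p q : \bar R) (I : R) :=
  (forall u v, (p < u%:E)%E -> u <= v -> (v%:E < q)%E ->
     exists J, is_RS f id u v J) /\
  proper_RS f id uv.1 uv.2 @[uv --> (from_right p, from_left q)] --> I.

Definition improper_Riemann f (p q : \bar R) : R :=
  xget 0 [set I | is_improper_Riemann f p q I].

End riemann_stieltjes.

Section levy.
Context {R : realType} {disp : measure_display} {T : measurableType disp}.
Variable P : probability T R.

Definition mutually_independent n (X : 'I_n -> T -> R) :=
  forall B : 'I_n -> set R, (forall i, measurable (B i)) ->
    P (\bigcap_(i in [set: 'I_n]) (X i @^-1` B i)) =
    (\prod_(i < n) P (X i @^-1` B i))%E.

Definition cadlag (f : R -> R) :=
  (forall t, 0 <= t -> f s @[s --> t^'+] --> f t) /\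
  (forall t, 0 < t -> cvg (f s @[s --> t^'-])).

(* Only the values X t for 0 <= t are relevant. *)
Record levy_process (X : R -> {RV P >-> R}) : Prop := LevyProcess {
  levy_start : {ae P, forall w, X 0 w = 0};
  levy_independent : forall n (t : nat -> R), 0 <= t 0%N ->
    (forall i, t i < t i.+1) ->
    mutually_independent (fun (i : 'I_n) w => X (t i.+1) w - X (t i) w);
  levy_stationary : forall (s t : R) (B : set R), 0 <= s -> s <= t -> measurable B ->
    P [set w | B (X t w - X s w)] = P [set w | B (X (t - s) w)];
  levy_stochastic_continuity : forall s eps : R, 0 <= s -> 0 < eps ->
    P [set w | eps < `|X t w - X s w|]
      @[t --> within [set t : R | 0 <= t] (nbhs s)] --> 0%E;
  levy_cadlag : {ae P, forall w, cadlag (X ^~ w)}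
}.

Definition same_law (X Y : R -> {RV P >-> R}) :=
  forall n (t : 'I_n -> R) (B : 'I_n -> set R),
    (forall i, 0 <= t i) -> (forall i, measurable (B i)) ->
    P (\bigcap_(i in [set: 'I_n]) (X (t i) @^-1` B i)) =
    P (\bigcap_(i in [set: 'I_n]) (Y (t i) @^-1` B i)).

Definition sigma_of (X : R -> {RV P >-> R}) : set (set T) :=
  <<s [set A | exists t (B : set R),
         [/\ 0 <= t, measurable B & A = X t @^-1` B]] >>.

Definition independent_processes (X Y : R -> {RV P >-> R}) :=
  forall A B, sigma_of X A -> sigma_of Y B -> P (A `&` B) = (P A * P B)%E.

Definition two_sided (L1 L2 : R -> {RV P >-> R}) (t : R) (w : T) : R :=
  if 0 <= t then L1 t w else lim (L2 s w @[s --> (- t)^'-]).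

Definition two_sided_levy_process (L : R -> T -> R) :=
  exists L1 L2 : R -> {RV P >-> R},
    [/\ levy_process L1, levy_process L2, same_law L1 L2,
        independent_processes L1 L2 & L = two_sided L1 L2].

Definition levy_measure (nu : {measure set (measurableTypeR R) -> \bar R}) :=
  nu [set 0] = 0%E /\ (\int[nu]_x (Num.min 1 (x ^+ 2))%:E < +oo)%E.

(* E[exp(i u X)] *)
Definition charfun (X : T -> R) (u : R) : R[i] :=
  ((\int[P]_w cos (u * X w)) +i* (\int[P]_w sin (u * X w)))%C.

Definition cexp (z : R[i]) : R[i] :=
  let: (x +i* y)%C := z in ((expR x * cos y) +i* (expR x * sin y))%C.

(* i gamma u - sigma2 u^2 / 2
     + \int (exp(i u x) - 1 - i u x 1_{|x| <= 1}) nu(dx) *)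
Definition levy_exponent (gamma sigma2 : R)
    (nu : {measure set (measurableTypeR R) -> \bar R}) (u : R) : R[i] :=
  ((- (sigma2 * u ^+ 2 / 2) + \int[nu]_x (cos (u * x) - 1))
   +i* (gamma * u
        + \int[nu]_x (sin (u * x) - u * x * (`|x| <= 1)%R%:R)))%C.

Definition characteristic_triplet (X : T -> R) (gamma sigma2 : R)
    (nu : {measure set (measurableTypeR R) -> \bar R}) :=
  [/\ 0 <= sigma2, levy_measure nu &
      forall u, charfun X u = cexp (levy_exponent gamma sigma2 nu u)].

Definition no_brownian_component (L : R -> T -> R) :=
  exists gamma nu, characteristic_triplet (L 1) gamma 0 nu.

Record FLP_driver (L : R -> T -> R) : Prop := FLPDriver {
  driver_levy : two_sided_levy_process L;
  driver_zero_mean : forall t, ('E_P[L t] = 0)%E;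
  driver_square_integrable : ('E_P[fun w => (L 1 w ^+ 2)%R] < +oo)%E;
  driver_no_brownian : no_brownian_component L
}.

End levy.

Section fractional_levy.
Context {R : realType} {T : Type}.

Definition Gamma (x : R) : R :=
  \int[lebesgue_measure]_(y in `]0, +oo[) (y `^ (x - 1) * expR (- y)).

(* As d - 1 != 0, [0 `^ (d - 1)] is 0, so this is (x)_+^(d-1), vanishing for
   x <= 0.  ([powR] is not 0 at negative arguments.) *)
Definition pos_powR (x r : R) : R := (Num.max x 0) `^ r.

Definition FLP_integrand (d : R) (L : R -> T -> R) (t : R) (w : T) (s : R) : R :=
  (pos_powR (t - s) (d - 1) - pos_powR (- s) (d - 1)) * L s w.

(* The pathwise modification of the L^2 integral
     1/Gamma(d+1) \int ((t-s)_+^d - (-s)_+^d) L(ds).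
   The integrand being singular at 0 and t, the improper Riemann integral over
   the real line is the sum of those over the three intervals they delimit. *)
Definition FLP (d : R) (L : R -> T -> R) (t : R) (w : T) : R :=
  let f := FLP_integrand d L t w in
  let m := Num.min 0 t in
  let M := Num.max 0 t in
  (Gamma d)^-1 * (improper_Riemann f -oo%E m%:E + improper_Riemann f m%:E M%:E
                  + improper_Riemann f M%:E +oo%E).

End fractional_levy.

(* Main.v *)
(* The proof is pathwise once two facts about almost every path l of the driving
   process are known: l has one-sided limits everywhere, and |l s| grows at most like
   (1 + |s|)^b for some b < 1 - d.

   Growth: since L has mean zero and independent stationary increments,
   E[L(t)^2] <= n E[L(1)^2] for t <= n. Ottaviani's inequality on dyadic grids of
   [0, 2^k] bounds the probability that sup |L| exceeds 2 * 2^(kb) by a constant times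
   2^(k(1 - 2b)), which is summable for b > 1/2; Borel-Cantelli and right continuity
   conclude. As d < 1/2, there is some b in ]1/2, 1 - d[.

   Pathwise part: l is Riemann integrable on compact sets away from the singularities
   of the kernel and the growth makes the kernel times l Lebesgue integrable, so the
   improper Riemann integrals defining L^d add up to one Lebesgue integral. Estimating
   the increments of that integral shows that L^d is continuous and of at most
   quadratic growth at -oo. Summation by parts, together with the mean value theorem
   applied to a primitive of L^d_s e^(lambda s), then gives the integral against L^d
   and its value. *)
Require Import Defs.
From HB Require Import structures.
From mathcomp Require Import all_boot all_order all_algebra.
From mathcomp Require Import ring lra.
From mathcomp Require Import all_classical all_reals all_analysis.
From mathcomp Require Import measurable_realfun.

Import Order.TTheory GRing.Theory Num.Theory.
Import numFieldNormedType.Exports.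

Local Open Scope classical_set_scope.
Local Open Scope ring_scope.

Set Implicit Arguments.
Unset Strict Implicit.
Unset Printing Implicit Defensive.

(** * Riemann-Stieltjes integrals *)

Section riemann_stieltjes_theory.
Context {R : realType}.
Implicit Types (f g h m Phi : R -> R) (s : seq R) (u v : R).

(** A path of [L] may jump at a dense set of times, and the kernel blows up at 0 and t. The Riemann
    integrals inside [FLP] therefore have to be handled for integrands that merely have one-sided
    limits, on intervals avoiding 0 and t. This case, continuous integrands and integration by parts
    all go through one criterion, [is_RS_cells]: increments of a candidate [Phi] are the integral as
    soon as the error on each short cell is at most the increment of a control function [m] whose
    total increase is small.

    The kernel vanishes for t = 0, so the integrand at t is itself an increment between 0 and t. The
    single estimate [integral_kernel_diff_le] thus yields integrability, continuity and growth of
    L^d together. Quadratic growth is good enough, since half of the exponential weight absorbs it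
    at -oo. *)

Lemma RS_sum_cons f g u x s (xi : nat -> R) :
  RS_sum f g u (x :: s) xi =
  f (xi 0%N) * (g x - g u) + RS_sum f g x s (xi \o S).
Proof. by rewrite /RS_sum /= big_ord_recl. Qed.

Lemma mesh_lt_cons u x s delta : mesh_lt u (x :: s) delta ->
  x - u < delta /\ mesh_lt x s delta.
Proof. by move=> H; split; [exact: (H 0%N)|move=> i si; exact: (H i.+1)]. Qed.

Lemma tags_cons u x s (xi : nat -> R) : tags u (x :: s) xi ->
  u <= xi 0%N <= x /\ tags x s (xi \o S).
Proof. by move=> H; split; [exact: (H 0%N)|move=> i si; exact: (H i.+1)]. Qed.

(** The increments of [Phi] and those of [m] both telescope along the partition, so the cellwise
    errors add up to one increment of [m]. *)
Lemma RS_sum_dist f g Phi m u v delta s (xi : nat -> R) :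
  (forall p c q, u <= p -> p <= c <= q -> q <= v -> q - p < delta ->
     `|f c * (g q - g p) - (Phi q - Phi p)| <= m q - m p) ->
  itv_partition u v s -> mesh_lt u s delta -> tags u s xi ->
  `|RS_sum f g u s xi - (Phi v - Phi u)| <= m v - m u.
Proof.
elim: s u xi => [|x s IH] u xi H.
  move=> /itv_partition_nil -> _ _.
  by rewrite /RS_sum big_ord0 !subrr normr0.
move=> us /mesh_lt_cons[xu ms] /tags_cons[x0 ts].
have ux : u < x by case: us => /= /andP[].
have xs := itv_partition_cons us; have xv := itv_partition_le xs.
rewrite RS_sum_cons.
have H1 := H _ _ _ (lexx u) x0 xv xu.
have H2 : `|RS_sum f g x s (xi \o S) - (Phi v - Phi x)| <= m v - m x.
  by apply: IH => // p c q xp; apply: H; exact: le_trans (ltW ux) xp.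
have -> : f (xi 0%N) * (g x - g u) + RS_sum f g x s (xi \o S) - (Phi v - Phi u) =
  (f (xi 0%N) * (g x - g u) - (Phi x - Phi u)) +
  (RS_sum f g x s (xi \o S) - (Phi v - Phi x)) by ring.
have -> : m v - m u = (m x - m u) + (m v - m x) by ring.
by rewrite (le_trans (ler_normD _ _))// lerD.
Qed.

Lemma is_RS_cells f g Phi u v : u <= v ->
  (forall eps, 0 < eps -> exists2 delta, 0 < delta & exists2 m : R -> R,
     m v - m u <= eps &
     forall p c q, u <= p -> p <= c <= q -> q <= v -> q - p < delta ->
     `|f c * (g q - g p) - (Phi q - Phi p)| <= m q - m p) ->
  is_RS f g u v (Phi v - Phi u).
Proof.
move=> uv H; split => // eps e0.
have [delta d0 [m me Hm]] := H (eps / 2) ltac:(lra).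
exists delta => // s xi us ms ts.
have := @RS_sum_dist f g Phi m u v delta s xi Hm us ms ts; lra.
Qed.

(** Uniqueness of the integral rests on this: without partitions that fine, every value would
    qualify vacuously. Steps of length [delta / 2] meet the strict mesh bound, and a remainder
    shorter than [delta] becomes the last cell. *)
Lemma exists_fine_partition u v delta : u <= v -> 0 < delta ->
  exists2 s, itv_partition u v s & mesh_lt u s delta.
Proof.
move=> uv d0.
suff H : forall n u, u <= v -> v - u < n%:R * (delta / 2) ->
    exists2 s, itv_partition u v s & mesh_lt u s delta.
  apply: (H (Num.truncn ((v - u) / (delta / 2))).+1) => //.
  by rewrite -ltr_pdivrMr ?divr_gt0//; exact: truncnS_gt.
elim=> [{uv}u uv|n IH {uv}u uv]; first by lra.
rewrite -natr1 mulrDl mul1r => h.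
have [vu|uv'] := leP v u.
  exists [::]; last by [].
  by split => //=; apply/eqP/le_anti; rewrite uv.
have [vd|vd] := ltP (v - u) delta.
  exists [:: v]; first exact: itv_partition1.
  by case.
have [||s us ms] := IH (u + delta / 2); [lra|lra|].
exists (u + delta / 2 :: s).
  have : itv_partition u (u + delta / 2) [:: u + delta / 2].
    by apply: itv_partition1; rewrite ltrDl; lra.
  by move/itv_partition_cat => /(_ _ _ us).
by case=> [_|i si] /=; [lra|exact: ms].
Qed.

Lemma is_RS_unique f g u v : is_subset1 [set I | is_RS f g u v I].
Proof.
move=> I J [uv HI] [_ HJ].
apply/eqP; rewrite -subr_eq0 -normr_le0; apply/ler_addgt0Pr => e e0.
rewrite add0r.
have [d1 d10 H1] := HI (e / 2) ltac:(lra).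
have [d2 d20 H2] := HJ (e / 2) ltac:(lra).
have [|s us ms] := @exists_fine_partition u v (Num.min d1 d2) uv.
  by rewrite lt_min d10.
pose xi i := (u :: s)`_i.
have ts : tags u s xi.
  move=> i si; rewrite lexx/=.
  by case: us => /(pathP 0) H _; rewrite ltW//; exact: H.
have m1 : mesh_lt u s d1 by move=> i /ms; rewrite lt_min => /andP[].
have m2 : mesh_lt u s d2 by move=> i /ms; rewrite lt_min => /andP[].
have := H1 _ _ us m1 ts; have := H2 _ _ us m2 ts.
rewrite [X in X < _]distrC.
move: (RS_sum _ _ _ _ _) => x h1 h2.
have -> : I - J = (I - x) + (x - J) by ring.
rewrite (le_trans (ler_normD _ _))//.
by rewrite distrC in h1; rewrite distrC in h2; lra.
Qed.

Lemma proper_RSE f g u v I : is_RS f g u v I -> proper_RS f g u v = I.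
Proof. by move=> H; exact: (xget_subset1 0 H (@is_RS_unique f g u v)). Qed.
End riemann_stieltjes_theory.

(** * Integration by parts, and integrals from a possibly infinite lower end *)

Section integration_by_parts.
Context {R : realType}.
Implicit Types (f df g E dE G h Phi : R -> R) (u v : R).

(** Heine's theorem by near-covering compactness: the radius, tending to 0 from the right, is the
    parameter that compactness makes common to all points. The point [y] may leave the segment, as
    [g] is continuous everywhere. *)
Lemma uniform_continuity_itv g u v eps : continuous g -> 0 < eps ->
  exists2 delta, 0 < delta &
    forall x y, x \in `[u, v] -> `|x - y| < delta -> `|g x - g y| <= eps.
Proof.
move=> cg e0.
have := @segment_compact R u v => /compact_near_coveringP.
move/(_ _ (0^'+ : set_system R)
  (fun (r : R) x => forall y, `|x - y| < r -> `|g x - g y| <= eps)).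
case=> [x _|].
  have /cvgrPdist_le /(_ (eps / 2)) := cg x.
  case/(_ ltac:(lra))/nbhs_ballP => r /= r0 Hr.
  exists (ball x (r / 2), [set z | z < r / 2]) => /=.
    split; first by apply: nbhsx_ballx; lra.
    by apply: nbhs_right_lt; lra.
  case=> x' z [/= xx' zr] y yz.
  rewrite -ball_normE /ball_/= in xx'.
  have h1 := Hr x'; have h2 := Hr y; rewrite -ball_normE /ball_/= in h1 h2.
  have {}h1 := h1 ltac:(lra).
  have {}h2 : `|g x - g y| <= eps / 2.
    apply: h2; have -> : x - y = (x - x') + (x' - y) by ring.
    by rewrite (le_lt_trans (ler_normD _ _))//; lra.
  have -> : g x' - g y = (g x - g y) - (g x - g x') by ring.
  by rewrite (le_trans (ler_normB _ _))//; lra.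
move=> r /= r0 Hr; exists (r / 2); first by lra.
move=> x y xuv; apply: (Hr (r / 2)) => //=; try lra.
by rewrite /ball_ /= sub0r normrN gtr0_norm; lra.
Qed.

Lemma is_derive_continuous f df : (forall x : R, is_derive x 1 f (df x)) ->
  continuous f.
Proof.
move=> H x; apply: differentiable_continuous; apply/derivable1_diffP.
by have [] := H x.
Qed.

Lemma le_increment f df M p q : p <= q ->
  (forall x : R, is_derive x 1 f (df x)) ->
  (forall x, p <= x <= q -> `|df x| <= M) -> `|f q - f p| <= M * (q - p).
Proof.
move=> pq Hf HM.
have [||c cpq ->] := @MVT_segment R f df p q => //.
  exact/continuous_subspaceT/is_derive_continuous.
by rewrite normrM (ger0_norm (_ : 0 <= q - p)) ?subr_ge0// ler_wpM2r
  ?subr_ge0// HM// -in_itv.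
Qed.

(* On a cell [p, q] with tag c,
   E c (g q - g p) - (E q g q - E p g p) + (G q - G p) splits into
   (G q - G c) - g q (E q - E c) and (G c - G p) - g p (E c - E p). *)
Lemma is_RS_by_parts E dE g G u v : u <= v ->
  continuous g -> continuous dE ->
  (forall x : R, is_derive x 1 E (dE x)) ->
  (forall x : R, is_derive x 1 G (g x * dE x)) ->
  is_RS E g u v ((E v * g v - G v) - (E u * g u - G u)).
Proof.
move=> uv cg cdE dEE dG.
have [M M0 HM] : exists2 M, 0 < M & forall x, x \in `[u, v] -> `|dE x| <= M.
  have [b _ Hb] := @EVT_max R (fun x => `|dE x|) u v uv
    ltac:(by apply: continuous_subspaceT => x; apply: continuous_comp;
      [exact: cdE|exact: norm_continuous]).
  exists (1 + `|dE b|); first by have := normr_ge0 (dE b); lra.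
  by move=> x /Hb; lra.
apply: (@is_RS_cells R E g (fun x => E x * g x - G x) u v uv) => eps e0.
(* The oscillation of [g] allowed on a cell: the control [M * w * x] then increases by at most [eps]
   over [u, v]. The [+ 1] keeps the denominator positive when u = v. *)
pose w := eps / (M * (v - u + 1)).
have den0 : 0 < M * (v - u + 1) by rewrite mulr_gt0//; lra.
have w0 : 0 < w by rewrite divr_gt0.
have [delta d0 Hd] := @uniform_continuity_itv g u v w cg w0.
exists delta => //; exists (fun x => (M * w) * x).
  have : M * w * (v - u + 1) = eps by rewrite /w; field; lra.
  by have : 0 < M * w by [rewrite mulr_gt0|]; nra.
move=> p c q up /andP[pc cq] qv qpd.
(* With [y] frozen, [G x - g y * E x] has derivative [(g x - g y) * dE x], of size at most [w * M]
   on the cell; the mean value inequality applies. *)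
have piece a b y : p <= a -> a <= b -> b <= q -> a <= y <= b ->
    `|(G b - g y * E b) - (G a - g y * E a)| <= M * w * (b - a).
  move=> pa ab bq /andP[ay yb].
  apply: (@le_increment (fun x => G x - g y * E x)
    (fun x => g x * dE x - g y * dE x)) => //.
  move=> x /andP[ax xb]; rewrite -mulrBl normrM mulrC.
  rewrite ler_pM//; first by apply: HM; rewrite in_itv/=; lra.
  by apply: Hd; [rewrite in_itv/=; lra|rewrite ltr_norml; lra].
have h1 := piece c q q pc cq (lexx _) ltac:(lra).
have h2 := piece p c p (lexx _) pc cq ltac:(lra).
have -> : E c * (g q - g p) - (E q * g q - G q - (E p * g p - G p)) =
  (G q - g q * E q - (G c - g q * E c)) + (G c - g p * E c - (G p - g p * E p)).
  by ring.
rewrite (le_trans (ler_normD _ _))//.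
by have -> : M * w * q - M * w * p = M * w * (q - c) + M * w * (c - p);
  [ring|exact: lerD].
Qed.

Lemma is_RS_primitive h Phi u v : u <= v -> continuous h ->
  (forall x : R, is_derive x 1 Phi (h x)) -> is_RS h id u v (Phi v - Phi u).
Proof.
move=> uv ch dPhi; apply: is_RS_cells => // eps e0.
pose w := eps / (v - u + 1).
have den0 : 0 < v - u + 1 by lra.
have w0 : 0 < w by rewrite divr_gt0.
have [delta d0 Hd] := @uniform_continuity_itv h u v w ch w0.
exists delta => //; exists (fun x => w * x).
  by have : w * (v - u + 1) = eps by [rewrite /w; field; lra|]; nra.
move=> p c q up /andP[pc cq] qv qpd.
have := @le_increment (fun x => h c * x - Phi x) (fun x => h c * 1 - h x) w p q.
rewrite -!mulrBr /=.
have -> : h c * (q - p) - (Phi q - Phi p) =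
          h c * q - Phi q - (h c * p - Phi p) by ring.
apply; first by lra.
move=> x /andP[px xq]; rewrite mulr1.
by apply: Hd; [rewrite in_itv/=; lra|rewrite ltr_norml; lra].
Qed.

Lemma is_RS_from_unique f g a t : is_subset1 [set I | is_RS_from f g a t I].
Proof.
case: a => [r||] I J /=; [exact: is_RS_unique|by []|].
by move=> [_ HI] [_]; exact: cvg_unique HI.
Qed.

Lemma RS_integralE f g a t I : is_RS_from f g a t I -> RS_integral f g a t = I.
Proof.
by move=> H; exact: (xget_subset1 0 H (@is_RS_from_unique f g a t)).
Qed.

Lemma is_RS_from_primitive f g Phi a t : (a < t%:E)%E ->
  (forall u, u <= t -> is_RS f g u t (Phi t - Phi u)) ->
  (a = -oo%E -> Phi r @[r --> -oo] --> 0) ->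
  is_RS_from f g a t (Phi t - (match a with r%:E => Phi r | _ => 0 end)).
Proof.
case: a => [r /= rt H _||_ H /(_ erefl) P0] //.
  by apply: H; rewrite ltW// -lte_fin.
split=> [u ut|]; first by exists (Phi t - Phi u); exact: H.
apply: (@cvg_trans _ ((Phi t - Phi u) @[u --> -oo])).
  apply: near_eq_cvg; near=> u; apply/esym/proper_RSE/H.
  by near: u; apply: nbhs_ninfty_le; exact: num_real.
by apply: cvgB => //; exact: cvg_cst.
Unshelve. all: by end_near. Qed.
End integration_by_parts.

(** * Functions with one-sided limits *)

Section regulated.
Context {R : realType}.
Implicit Types (f F : R -> R) (u v x : R).
Notation mu := (@lebesgue_measure R).

Definition one_sided_limits f x :=
  cvg (f y @[y --> x^'+]) /\ cvg (f y @[y --> x^'-]).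

(** Compactness as an induction principle: the supremum of the [w] with [Q u w] could be passed by
    half of its local radius, unless [v] is already within reach. *)
Lemma segment_ind (Q : R -> R -> Prop) u v : u <= v ->
  (forall x, u <= x <= v -> exists2 r, 0 < r &
     forall p q, x - r < p -> p <= q -> q < x + r -> Q p q) ->
  (forall p w q, p <= w -> w <= q -> Q p w -> Q w q -> Q p q) ->
  Q u v.
Proof.
move=> uv Qloc Qadd.
pose S := [set w | u <= w <= v /\ Q u w].
have Su : S u.
  split; first by rewrite lexx.
  by have [|r r0 Hr] := Qloc u; [rewrite lexx|apply: Hr; lra].
have supS : has_sup S by split; [exists u|exists v => w [/andP[]]].
have us : u <= sup S by exact: sup_upper_bound.
have sv : sup S <= v by apply: ge_sup => [|w [/andP[]]//]; exists u.
have [|r r0 Hr] := Qloc (sup S); first by rewrite us.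
have [w [/andP[uw wv] Quw] sw] := sup_adherent r0 supS.
have ws : w <= sup S by apply: sup_upper_bound => //; split=> //; rewrite uw.
have Qw z : w <= z -> z < sup S + r -> Q u z.
  by move=> wz zs; apply: (Qadd _ w) => //; exact: Hr.
have [vs|vs] := ltP v (sup S + r); first exact: Qw.
suff : sup S + r / 2 <= sup S by lra.
by apply: sup_upper_bound => //; split; [lra|apply: Qw; lra].
Qed.

(** The value at [x] is unrelated to the two limits. Excluding [x] from [y, z] puts both points on
    the same side, where they are compared through the limit of that side. *)
Lemma one_sided_limits_near f x e : one_sided_limits f x -> 0 < e ->
  exists2 r, 0 < r & forall y z, x - r < y -> y <= z -> z < x + r ->
    ~~ (y <= x <= z) -> `|f y - f z| <= e.
Proof.
move=> [/cvg_ex[l1 /= fl1] /cvg_ex[l2 /= fl2]] e0.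
move/cvgrPdist_le : fl1 => /(_ (e / 2) ltac:(lra)).
move/nbhs_ballP => [r1 /= r10 H1].
move/cvgrPdist_le : fl2 => /(_ (e / 2) ltac:(lra)).
move/nbhs_ballP => [r2 /= r20 H2].
have HR y : x < y -> y < x + r1 -> `|l1 - f y| <= e / 2.
  by move=> xy yr; apply: (H1 y) => //=; rewrite -ball_normE /ball_/= ltr_norml; lra.
have HL y : y < x -> x - r2 < y -> `|l2 - f y| <= e / 2.
  by move=> xy yr; apply: (H2 y) => //=; rewrite -ball_normE /ball_/= ltr_norml; lra.
exists (Num.min r1 r2); first by rewrite lt_min r10.
move=> y z xy yz zx; rewrite negb_and -!ltNge.
have [m1 m2] : Num.min r1 r2 <= r1 /\ Num.min r1 r2 <= r2.
  by rewrite !ge_min !lexx orbT.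
case/orP => h.
  have h1 := HR y h ltac:(lra); have h2 := HR z ltac:(lra) ltac:(lra).
  have -> : f y - f z = (l1 - f z) - (l1 - f y) by ring.
  by rewrite (le_trans (ler_normB _ _))//; lra.
have h1 := HL z h ltac:(lra); have h2 := HL y ltac:(lra) ltac:(lra).
have -> : f y - f z = (l2 - f z) - (l2 - f y) by ring.
by rewrite (le_trans (ler_normB _ _))//; lra.
Qed.

(** Jumps may be dense, but only finitely many exceed a given size; these are collected in [xs].
    When two pieces are glued at [w], this point joins [xs], so that an admissible [y, z] stays
    inside one piece. *)
Lemma regulated_oscillation f u v e : u <= v -> 0 < e ->
  (forall x, u <= x <= v -> one_sided_limits f x) ->
  exists xs : seq R, forall y z, u <= y -> y <= z -> z <= v ->
    {in xs, forall x, ~~ (y <= x <= z)} -> `|f y - f z| <= e.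
Proof.
move=> uv e0 flim; apply: (@segment_ind (fun u v => exists xs : seq R,
    forall y z, u <= y -> y <= z -> z <= v ->
    {in xs, forall x, ~~ (y <= x <= z)} -> `|f y - f z| <= e) _ _ uv) => [x /flim fx|p w q pw wq].
  have [r r0 Hr] := one_sided_limits_near fx e0; exists r => // p q xp pq qx.
  exists [:: x] => y z py yz zq /(_ x); rewrite mem_seq1 eqxx => /(_ isT).
  by apply: Hr; lra.
move=> [xs1 H1] [xs2 H2]; exists (w :: xs1 ++ xs2) => y z py yz zq Hx.
have := Hx w; rewrite mem_head => /(_ isT); rewrite negb_and -!ltNge => /orP[] h.
- apply: H2 => //; first exact: ltW.
  by move=> x xs; apply: Hx; rewrite inE mem_cat xs !orbT.
- apply: H1 => //; first exact: ltW.
  by move=> x xs; apply: Hx; rewrite inE mem_cat xs !orbT.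
Qed.

Lemma regulated_bounded f u v : u <= v ->
  (forall x, u <= x <= v -> one_sided_limits f x) ->
  exists M, forall y, u <= y <= v -> `|f y| <= M.
Proof.
move=> uv flim; apply: (@segment_ind (fun u v => exists M,
    forall y, u <= y <= v -> `|f y| <= M) _ _ uv) => [x /flim fx|p w q pw wq].
  have [r r0 Hr] := one_sided_limits_near fx ltr01; exists r => // p q xp pq qx.
  (* Each side of [x] is compared with one reference point of that side, at oscillation at most 1;
     the value at [x] is counted apart. *)
  exists (`|f x| + `|f (x - r / 2)| + `|f (x + r / 2)| + 1).
  move=> y /andP[py yq].
  have := normr_ge0 (f x); have := normr_ge0 (f (x - r / 2)).
  have := normr_ge0 (f (x + r / 2)).
  have tri z : `|f y| <= `|f z| + `|f z - f y|.
    by have := ler_normD (f z) (f y - f z); rewrite subrKC distrC.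
  have [xy|yx|->] := ltgtP x y; last by lra.
    have := tri (x + r / 2).
    suff : `|f (x + r / 2) - f y| <= 1 by lra.
    have [h|h] := leP y (x + r / 2).
      rewrite distrC; apply: Hr; [lra|lra|lra|].
      by rewrite negb_and -!ltNge xy.
    by apply: Hr; [lra|lra|lra|rewrite negb_and -!ltNge; lra].
  have := tri (x - r / 2).
  suff : `|f (x - r / 2) - f y| <= 1 by lra.
  have [h|h] := leP (x - r / 2) y.
    by apply: Hr; [lra|lra|lra|rewrite negb_and -!ltNge yx orbT].
  by rewrite distrC; apply: Hr; [lra|lra|lra|rewrite negb_and -!ltNge; lra].
move=> [M1 H1] [M2 H2]; exists (Num.max M1 M2) => y /andP[py yq].
rewrite le_max; have [yw|wy] := leP y w.
  by rewrite H1// py.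
by rewrite H2 ?orbT// yq ltW.
Qed.

Lemma dist_seq_gt0 x (xs : seq R) : x \notin xs ->
  exists2 r, 0 < r & {in xs, forall y, r <= `|x - y|}.
Proof.
elim: xs => [_|y xs IH]; first by exists 1.
rewrite inE negb_or => /andP[xy /IH[r r0 Hr]].
exists (Num.min r `|x - y|); first by rewrite lt_min r0 normr_gt0 subr_eq0.
move=> z; rewrite inE => /predU1P[->|/Hr]; first by rewrite ge_min lexx orbT.
by rewrite ge_min => ->.
Qed.

(** Off the countable set [D] of all exceptional points, for oscillation 1/(n + 1) on [-n, n], the
    function is continuous; on [D] every subset is measurable. *)
Lemma regulated_measurable f : (forall x, one_sided_limits f x) ->
  measurable_fun setT f.
Proof.
move=> flim.
have /choice[xs Hxs] : forall n, exists xs : seq R,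
    forall y z, - n%:R <= y -> y <= z -> z <= n%:R ->
    {in xs, forall x, ~~ (y <= x <= z)} -> `|f y - f z| <= n.+1%:R^-1.
  move=> n; apply: regulated_oscillation; last by move=> x _.
    by rewrite (@le_trans _ _ 0)// oppr_le0.
  by rewrite invr_gt0.
pose D := \bigcup_n [set` xs n].
have cD : countable D.
  by apply: bigcup_countable => // n _; exact/finite_set_countable.
have mD : measurable D by apply: countable_measurable cD => t; exact: measurable_set1.
rewrite -(setvU D); apply/measurable_funU => //; first exact: measurableC.
split; last first.
  move=> _ Y mY; apply: countable_measurable; first exact: measurable_set1.
  by apply: sub_countable cD; apply: subset_card_le; exact: subIsetl.
apply: subspace_continuous_measurable_fun; first exact: measurableC.
apply: continuous_in_subspaceT => x /[!inE] Dx.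
apply/cvgrPdist_le => /= e e0.
(* One index with two tasks: 1/(n + 1) <= e, and [x] strictly inside [-n, n]. *)
pose n := (maxn (Num.truncn e^-1) (Num.truncn `|x|).+1).
have ne : n.+1%:R^-1 <= e.
  rewrite -[leRHS]invrK lef_pV2 ?posrE ?invr_gt0// ltW//.
  by rewrite (lt_le_trans (truncnS_gt _))// ler_nat ltnS leq_maxl.
have nx : `|x| < n%:R.
  by rewrite (lt_le_trans (truncnS_gt _))// ler_nat leq_maxr.
have [r r0 Hr] : exists2 r, 0 < r & {in xs n, forall y, r <= `|x - y|}.
  by apply: dist_seq_gt0; apply/negP => xn; apply: Dx; exists n.
have m0 : 0 < Num.min r (n%:R - `|x|) by rewrite lt_min r0 subr_gt0.
apply/nbhs_ballP; exists (Num.min r (n%:R - `|x|)) => //= y.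
rewrite /ball /= lt_min => /andP[xyr xyn].
apply: le_trans ne.
have yn : `|y| < n%:R.
  have -> : y = x - (x - y) by ring.
  by rewrite (le_lt_trans (ler_normB _ _))//; lra.
move: nx yn; rewrite !ltr_norml => /andP[n1 n2] /andP[n3 n4].
have [xy|yx] := leP x y; last rewrite distrC.
all: apply: Hxs; [lra|lra|lra|]; move=> z /Hr; apply: contraL => /andP[h1 h2];
  rewrite -ltNge; move: xyr; rewrite !ltr_norml; lra.
Qed.

Lemma Rintegral_cell_dist f p q c K : p <= q -> 0 <= K ->
  mu.-integrable `]p, q] (EFin \o f) ->
  (forall x, p < x <= q -> `|f c - f x| <= K) ->
  `|f c * (q - p) - \int[mu]_(x in `]p, q]) f x| <= K * (q - p).
Proof.
move=> pq K0 fi H.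
have muE : fine (mu `]p, q]%classic) = q - p.
  rewrite lebesgue_measure_itv/= lte_fin; case: ifPn => //=.
  by rewrite -leNgt => qp; have -> : p = q by [apply/le_anti; rewrite pq|]; rewrite subrr.
have muF : (mu `]p, q]%classic < +oo)%E.
  by rewrite lebesgue_measure_itv/= lte_fin; case: ifPn => // _; rewrite -EFinD ltry.
have ci r : mu.-integrable `]p, q] (EFin \o cst r : R -> \bar R).
  apply: measurable_bounded_integrable => //.
  by exists `|r|; split; [exact: num_real|move=> x rx y _ /=; exact: ltW].
have <- : \int[mu]_(x in `]p, q]) (cst (f c) x) = f c * (q - p).
  by rewrite Rintegral_cst// muE.
rewrite -RintegralB//=.
have bi : mu.-integrable `]p, q] (EFin \o (fun x => f c - f x)).
  by apply: eq_integrable (integrableB _ (ci (f c)) fi).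
rewrite (le_trans (le_normr_Rintegral _ bi))//.
have <- : \int[mu]_(x in `]p, q]) (cst K x) = K * (q - p).
  by rewrite Rintegral_cst// muE.
by apply: le_Rintegral => //=; exact: (integrable_abse bi).
Qed.

(** The identity cut off at distance [r] from [x] is a control function for the cells around [x]: it
    is nondecreasing, grows like the identity on short cells containing [x], and increases by at
    most 2r in all, as this and the next two lemmas show. *)
Lemma clip_le x p q r : 0 < r -> p <= q ->
  Num.min (Num.max p (x - r)) (x + r) <= Num.min (Num.max q (x - r)) (x + r).
Proof.
move=> r0 pq; rewrite /Num.min /Num.max.
by case: (ltP p (x - r)) => ?; case: (ltP q (x - r)) => ?;
  do ?[case: ifPn; rewrite -?leNgt => ?]; lra.
Qed.

Lemma clip_id x p q r : 0 < r -> p <= x <= q -> q - p < r ->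
  Num.min (Num.max q (x - r)) (x + r) - Num.min (Num.max p (x - r)) (x + r) =
  q - p.
Proof.
move=> r0 /andP[px xq] qpr; rewrite !max_l ?min_l; lra.
Qed.

Lemma clip_dist x p q r : 0 < r ->
  Num.min (Num.max q (x - r)) (x + r) - Num.min (Num.max p (x - r)) (x + r) <=
  2 * r.
Proof.
move=> r0; rewrite /Num.min /Num.max.
by case: (ltP p (x - r)) => ?; case: (ltP q (x - r)) => ?;
  do ?[case: ifPn; rewrite -?leNgt => ?]; lra.
Qed.

Lemma is_RS_regulated f F u v : u <= v ->
  (forall x, u <= x <= v -> one_sided_limits f x) ->
  mu.-integrable `]u, v] (EFin \o f) ->
  (forall p q, u <= p -> p <= q -> q <= v ->
     F q - F p = \int[mu]_(x in `]p, q]) f x) ->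
  is_RS f id u v (F v - F u).
Proof.
move=> uv flim fi FE.
have [M HM] := regulated_bounded uv flim.
have M0 : 0 <= M by rewrite (le_trans _ (HM u _))// lexx.
apply: is_RS_cells => // eps e0.
pose w := eps / 2 / (v - u + 1).
have w0 : 0 < w by rewrite divr_gt0//; lra.
have [xs Hxs] := regulated_oscillation uv w0 flim.
pose N : R := (size xs)%:R.
have N0 : 0 <= N by rewrite ler0n.
(* Cells meeting [xs] have error at most 2M times their length and are charged to [N] cut-off
   functions of increase at most [2 * delta]; the resulting 4MN delta stays below [eps / 2]. The
   other half pays for the cells avoiding [xs]. *)
pose delta := eps / 2 / (4 * (M + 1) * (N + 1)).
have den0 : 0 < 4 * (M + 1) * (N + 1).
  by rewrite pmulr_lgt0 ?pmulr_rgt0//; lra.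
have d0 : 0 < delta by rewrite divr_gt0//; lra.
(* Every cell that meets the exceptional set [xs] lies in some
   [x - delta, x + delta]; the increments of [clip x] measure such cells. *)
pose clip x t := Num.min (Num.max t (x - delta)) (x + delta).
have clipP x p q : p <= q -> clip x p <= clip x q by exact: clip_le.
have clipE x p q : p <= x <= q -> q - p < delta -> clip x q - clip x p = q - p.
  exact: clip_id.
have clipd x p q : clip x q - clip x p <= 2 * delta by exact: clip_dist.
pose m t := w * t + 2 * M * \sum_(x <- xs) clip x t.
have mB p q : m q - m p =
    w * (q - p) + 2 * M * \sum_(x <- xs) (clip x q - clip x p).
  by rewrite sumrB /m; ring.
exists delta => //; exists m.
  have sle : \sum_(x <- xs) (clip x v - clip x u) <= N * (2 * delta).
    apply: (@le_trans _ _ (\sum_(x <- xs) (2 * delta))).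
      exact: ler_sum.
    by rewrite big_const_seq count_predT iter_addr_0 -[leLHS]mulr_natl.
  have h1 : w * (v - u + 1) = eps / 2 by rewrite /w; field; lra.
  have h2 : delta * (4 * (M + 1) * (N + 1)) = eps / 2 by rewrite /delta; field; lra.
  rewrite mB.
  have : 2 * M * (\sum_(x <- xs) (clip x v - clip x u)) <= 2 * M * (N * (2 * delta)).
    by rewrite ler_wpM2l// mulr_ge0.
  have : 0 <= M * delta by rewrite mulr_ge0// ltW.
  have : 0 <= N * delta by rewrite mulr_ge0// ltW.
  have : M * (N * delta) * 4 <= delta * (4 * (M + 1) * (N + 1)) by nra.
  nra.
move=> p c q up /andP[pc cq] qv qpd; have pq := le_trans pc cq.
have pqi : mu.-integrable `]p, q] (EFin \o f).
  apply: integrableS fi => //=.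
  by apply: subset_itv; rewrite bnd_simp.
rewrite FE// mB.
have S0 : 0 <= \sum_(x <- xs) (clip x q - clip x p).
  by apply: sumr_ge0 => x _; rewrite subr_ge0 clipP.
have [/hasP[x xxs xpq]|/hasPn nxs] := boolP (has (fun x => p <= x <= q) xs).
  have le1 : q - p <= \sum_(x <- xs) (clip x q - clip x p).
    rewrite -(clipE x p q xpq qpd) (big_rem x)//= lerDl.
    by apply: sumr_ge0 => y _; rewrite subr_ge0 clipP.
  apply: (@le_trans _ _ (2 * M * (q - p))).
    apply: Rintegral_cell_dist => //; first by rewrite mulr_ge0.
    move=> y /andP[py yq]; rewrite (le_trans (ler_normB _ _))//.
    have -> : 2 * M = M + M by ring.
    by apply: lerD; apply: HM; lra.
  have : 0 <= w * (q - p) by rewrite mulr_ge0 ?subr_ge0// ltW.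
  have : 2 * M * (q - p) <= 2 * M * \sum_(x <- xs) (clip x q - clip x p).
    by rewrite ler_wpM2l// mulr_ge0.
  lra.
apply: (@le_trans _ _ (w * (q - p))); last first.
  by rewrite lerDl mulr_ge0// mulr_ge0.
apply: Rintegral_cell_dist => //; first exact: ltW.
move=> y /andP[py yq]; have [cy|yc] := leP c y; last rewrite distrC.
all: by apply: Hxs; [lra|lra|lra|]; move=> x /nxs; apply: contra; lra.
Qed.
End regulated.

(** * The fractional kernel *)

Section kernel.
Context {R : realType}.
Notation mu := (@lebesgue_measure R).

(* A has to be exhausted from inside since the primitive may be singular at its
   ends. *)
Lemma integral_le_primitive (f F : R -> R) (A : set R) (u v : nat -> R) (M : R) :
  (forall n, u n < v n) ->
  nondecreasing_seq (fun n => `[u n, v n]%classic : set R) ->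
  A = \bigcup_n `[u n, v n]%classic ->
  (forall x, A x -> [/\ 0 <= f x, is_derive x 1 F (f x) & {for x, continuous f}]) ->
  (forall n, F (v n) - F (u n) <= M) ->
  (\int[mu]_(x in A) (f x)%:E <= M%:E)%E.
Proof.
move=> uv ndA -> H FM.
have cf n : {within `[u n, v n], continuous f}.
  apply: continuous_in_subspaceT => x /[!inE] xn.
  by have [] := H x; first by exists n.
have mf n : measurable_fun `[u n, v n] (EFin \o f).
  apply/measurable_EFinP; apply: subspace_continuous_measurable_fun => //.
have f0 n x : `[u n, v n]%classic x -> (0 <= (EFin \o f) x)%E.
  by move=> xn; rewrite /= lee_fin; have [] := H x; first by exists n.
have cv := ge0_nondecreasing_set_cvg_integral
  (mu := lebesgue_measure) ndA (fun n => measurable_itv _) mf f0.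
rewrite -(cvg_lim _ cv)//; apply: lime_le; first by apply/cvg_ex; eexists; exact: cv.
apply: nearW => n /=.
rewrite (@continuous_FTC2 _ f F) //; first by rewrite -EFinD lee_fin.
  have cF x : `[u n, v n]%classic x -> {for x, continuous F}.
    move=> xn; apply: differentiable_continuous; apply/derivable1_diffP.
    by have [|_ []] := H x; first by exists n.
  have uvn := uv n.
  split.
  - move=> x xn; have [|_ []//] := H x; exists n => //=.
    exact: subset_itv_oo_cc xn.
  - by apply: cvg_at_right_filter; apply: cF; rewrite /= in_itv/= lexx ltW.
  - by apply: cvg_at_left_filter; apply: cF; rewrite /= in_itv/= lexx ltW.
move=> x xn; rewrite derive1E; have [|_ dF _] := H x; last exact: derive_val.
exists n => //=; exact: subset_itv_oo_cc xn.
Qed.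

Lemma integral_le_primitive_co (f F : R -> R) (a b M : R) : a < b ->
  (forall x, a <= x < b -> [/\ 0 <= f x, is_derive x 1 F (f x) & {for x, continuous f}]) ->
  (forall x, a <= x < b -> F x - F a <= M) ->
  (\int[mu]_(x in `[a, b[) (f x)%:E <= M%:E)%E.
Proof.
move=> ab H FM.
have in1 (n : nat) : (n.+2%:R)^-1 < 1 :> R by rewrite invf_lt1// ltr1n.
have lt1 (n : nat) : (b - a) / n.+2%:R < b - a by rewrite gtr_pMr ?subr_gt0.
have gt0 (n : nat) : 0 < (b - a) / n.+2%:R by rewrite divr_gt0 ?subr_gt0.
(* The shift by 2 makes the interval nondegenerate already at n = 0. *)
apply: (@integral_le_primitive f F _ (fun=> a) (fun n => b - (b - a) / n.+2%:R)).
- by move=> n; rewrite ltrBrDr addrC -ltrBrDr.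
- move=> n m nm; rewrite subsetEset; apply: subset_itvl; rewrite bnd_simp.
  rewrite lerB// ler_wpM2l ?subr_ge0 ?(ltW ab)//.
  by rewrite lef_pV2 ?posrE// ler_nat !ltnS.
- apply/seteqP; split=> x /=.
    rewrite in_itv/= => /andP[ax xb].
    exists (Num.truncn ((b - a) / (b - x))) => //=.
    rewrite in_itv/= ax/= lerBrDr addrC -lerBrDr ler_pdivrMr// mulrC.
    rewrite -ler_pdivrMr ?subr_gt0//.
    by rewrite ltW// (lt_trans (truncnS_gt _))// ltr_nat.
  move=> [n _ /=]; rewrite !in_itv/= => /andP[-> /le_lt_trans]; apply.
  by rewrite ltrBlDr ltrDl divr_gt0// subr_gt0.
- by move=> x /=; rewrite in_itv/=; exact: H.
- move=> n; apply: FM; rewrite lerBrDr addrC -lerBrDr (ltW (lt1 n))/=.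
  by rewrite gtrBl.
Qed.

Lemma integral_le_primitive_Nyc (f F : R -> R) (c M : R) :
  (forall x, x <= c -> [/\ 0 <= f x, is_derive x 1 F (f x) & {for x, continuous f}]) ->
  (forall x, x <= c -> F c - F x <= M) ->
  (\int[mu]_(x in `]-oo, c]) (f x)%:E <= M%:E)%E.
Proof.
move=> H FM.
apply: (@integral_le_primitive f F _ (fun n => c - n.+1%:R) (fun=> c)).
- by move=> n; rewrite ltrBlDr ltrDl ltr0n.
- move=> n m nm; rewrite subsetEset; apply: subset_itvr; rewrite bnd_simp.
  by rewrite lerB// ler_nat ltnS.
- apply/seteqP; split=> x /=.
    rewrite in_itv/= => xc.
    exists (Num.truncn (c - x)) => //=.
    rewrite in_itv/= xc andbT lerBlDr addrC -lerBlDr.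
    by rewrite ltW// truncnS_gt.
  by move=> [n _ /=]; rewrite !in_itv/= => /andP[].
- by move=> x /=; rewrite in_itv/=; exact: H.
- by move=> n; apply: FM; rewrite lerBlDr lerDl.
Qed.

Lemma integral_le_scaled (A : set R) (f g : R -> R) k M : measurable A ->
  measurable_fun A f -> measurable_fun A g -> 0 <= k ->
  (forall x, A x -> 0 <= g x) ->
  (forall x, A x -> 0 <= f x <= k * g x) ->
  (\int[mu]_(x in A) (g x)%:E <= M%:E)%E ->
  (\int[mu]_(x in A) (f x)%:E <= (k * M)%:E)%E.
Proof.
move=> mA mf mg k0 g0 fg gM.
apply: (@le_trans _ _ (\int[mu]_(x in A) (k%:E * (g x)%:E))%E).
  apply: ge0_le_integral => //=.
  - by move=> x Ax; rewrite lee_fin; case/andP: (fg x Ax).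
  - exact/measurable_EFinP.
  - by under eq_fun do rewrite -EFinM; apply/measurable_EFinP; exact: measurable_funM.
  - by move=> x Ax; rewrite -EFinM lee_fin; case/andP: (fg x Ax).
rewrite ge0_integralZl//=; first by rewrite EFinM lee_wpmul2l// lee_fin.
- exact/measurable_EFinP.
Qed.

Lemma integral_itv_split (f : R -> \bar R) (a c b : itv_bound R) :
  measurable_fun setT f -> (forall x, (0 <= f x)%E) -> (a <= c)%O -> (c <= b)%O ->
  (\int[mu]_(x in [set` Interval a b]) f x =
   \int[mu]_(x in [set` Interval a c]) f x +
   \int[mu]_(x in [set` Interval c b]) f x)%E.
Proof.
move=> mf f0 ac cb; rewrite (itv_bndbnd_setU ac cb) ge0_integral_setU//.
  exact: measurable_funTS.
rewrite disj_set2E; apply/eqP/seteqP; split=> // x [/=].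
rewrite !itv_boundlr => /andP[_ xc] /andP[cx _].
by have := le_trans xc cx; rewrite bnd_simp ltxx.
Qed.

(** Write (x + y)^r as x (x + y)^(r - 1) + y (x + y)^(r - 1); the exponent r - 1 being at most 0,
    shrinking the base to x or to y increases each power. *)
Lemma powRD_le (x y r : R) : 0 <= x -> 0 <= y -> 0 < r <= 1 ->
  (x + y) `^ r <= x `^ r + y `^ r.
Proof.
move=> x0 y0 /andP[r0 r1].
have [->|xN0] := eqVneq x 0; first by rewrite add0r lerDr powR_ge0.
have [->|yN0] := eqVneq y 0; first by rewrite addr0 lerDl powR_ge0.
have xp : 0 < x by rewrite lt_neqAle eq_sym xN0.
have yp : 0 < y by rewrite lt_neqAle eq_sym yN0.
have anti a b : 0 < a -> a <= b -> b `^ (r - 1) <= a `^ (r - 1).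
  move=> a0 ab; have b0 := lt_le_trans a0 ab.
  rewrite -[r - 1]opprB !powRN lef_pV2 ?posrE ?powR_gt0//.
    by apply: ge0_ler_powR; rewrite ?nnegrE; lra.
rewrite -(@mulr_powRB1 _ (x + y))//; last by lra.
rewrite -(@mulr_powRB1 _ x)// -(@mulr_powRB1 _ y)// mulrDl.
by apply: lerD; apply: ler_wpM2l => //; apply: anti => //; lra.
Qed.

Lemma is_derive_powR_refl (c a x : R) : x < c ->
  is_derive x 1 (fun s : R => (c - s) `^ a) (- (a * (c - x) `^ (a - 1))).
Proof.
move=> xc.
have d1 := @is_derive1_powR R a (c - x) ltac:(lra).
have d2 : is_derive x 1 (fun s : R => c - s) (-1).
  by rewrite -[-1]sub0r; exact: is_deriveB.
have := @is_derive1_comp R (fun y : R => y `^ a) (fun s : R => c - s) x _ _ d1 d2.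
by rewrite mulrN1.
Qed.

Lemma continuous_powR_refl (c a x : R) : x < c ->
  {for x, continuous (fun s : R => (c - s) `^ a)}.
Proof.
move=> xc; apply: differentiable_continuous; apply/derivable1_diffP.
by have [] := @is_derive_powR_refl c a x xc.
Qed.

Definition FLP_kernel (d t s : R) : R :=
  pos_powR (t - s) (d - 1) - pos_powR (- s) (d - 1).

Lemma pos_powR_gt0E (x r : R) : 0 < x -> pos_powR x r = x `^ r.
Proof. by move=> x0; rewrite /pos_powR max_l// ltW. Qed.

Lemma pos_powR_le0E (x r : R) : r != 0 -> x <= 0 -> pos_powR x r = 0.
Proof. by move=> r0 x0; rewrite /pos_powR max_r// powR0. Qed.

Lemma measurable_pos_powR (r : R) (f : R -> R) : measurable_fun setT f ->
  measurable_fun setT (fun x => pos_powR (f x) r).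
Proof.
move=> mf; apply: (measurableT_comp (measurable_powR r)).
by apply: measurable_maxr => //; exact: measurable_cst.
Qed.

Lemma measurable_FLP_kernel d t : measurable_fun setT (FLP_kernel d t).
Proof.
apply: measurable_funB; apply: measurable_pos_powR.
  by apply: measurable_funB => //; exact: measurable_cst.
exact: oppr_measurable.
Qed.

(* (1 + h / r)^(d - 1) >= (1 + h / r)^-1 >= 1 - h / r *)
Lemma powR_sub_le (d r h : R) : 0 < d < 1 -> 0 < r -> 0 <= h ->
  0 <= r `^ (d - 1) - (r + h) `^ (d - 1) <= h * r `^ (d - 2).
Proof.
move=> /andP[d0 d1] r0 h0.
have rh : 0 < r + h by lra.
have P0 := powR_gt0 (d - 1) r0; have Q0 := powR_gt0 (d - 1) rh.
have anti : (r + h) `^ (d - 1) <= r `^ (d - 1).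
  rewrite -[d - 1]opprB !powRN lef_pV2 ?posrE ?powR_gt0//.
  by apply: ge0_ler_powR; rewrite ?nnegrE; lra.
have E1 : r `^ (d - 2) * r = r `^ (d - 1).
  rewrite -[X in _ * X]powRr1 ?ltW// -powRD; last by apply/implyP => _; exact: lt0r_neq0.
  by congr (_ `^ _); ring.
(* Divided by r^(d - 1) (r + h), this is the bound (1 + h / r)^(d - 1) >= (1 + h / r)^-1. *)
have mono : r `^ d <= (r + h) `^ d.
  by apply: ge0_ler_powR; rewrite ?nnegrE; lra.
rewrite -(mulr_powRB1 (ltW r0) d0) -(mulr_powRB1 (ltW rh) d0) in mono.
have S0 := powR_gt0 (d - 2) r0.
apply/andP; split; first by lra.
rewrite -(ler_pM2l r0).
have -> : r * (h * r `^ (d - 2)) = h * (r `^ (d - 2) * r) by ring.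
by rewrite E1; nra.
Qed.

(* On [t - 1, t + h] the path is bounded and the kernel difference has integral at
   most 2 h^d / d; on ]-oo, t - 1[ the kernel difference is at most h (t - s)^(d - 2),
   which is integrable against |s|^b because b < 1 - d. *)
Lemma integral_kernel_diff_le (d b C : R) (l : R -> R) (t h : R) :
  0 < d < 1 -> 0 < b -> b < 1 - d -> 0 <= C -> measurable_fun setT l ->
  (forall s, `|l s| <= C * (1 + `|s|) `^ b) -> 0 < h ->
  (\int[mu]_(s in [set: R]) `|(FLP_kernel d (t + h) s - FLP_kernel d t s) * l s|%:E <=
  (C * (2 + `|t| + h) * (2 * (h `^ d / d) + h / (1 - d - b)))%:E)%E.
Proof.
move=> d01 b0 bd C0 ml lC h0; have [d0 d1] := andP d01.
have b1 : b <= 1 by lra.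
have dN0 : d - 1 != 0 by rewrite subr_eq0 lt_eqF.
pose D s := FLP_kernel d (t + h) s - FLP_kernel d t s.
have DE s : D s = pos_powR (t + h - s) (d - 1) - pos_powR (t - s) (d - 1).
  by rewrite /D /FLP_kernel; ring.
have mD : measurable_fun setT (fun s : R => `|D s * l s|).
  apply: measurableT_comp => //; apply: measurable_funM => //.
  by apply: measurable_funB; exact: measurable_FLP_kernel.
have mDA A : measurable_fun A (fun s : R => `|D s * l s|).
  exact: measurable_funS mD.
have lW (s : R) : t - 1 <= s <= t + h -> `|l s| <= C * (2 + `|t| + h).
  move=> ts; apply: (le_trans (lC s)); apply: ler_wpM2l => //.
  apply: (@le_trans _ _ (1 + `|s|)).
    by apply: ler1_powR; rewrite ?lerDl.
  by case: (ger0P s) => ?; case: (ger0P t) => ?; lra.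
have CW0 : 0 <= C * (2 + `|t| + h) by rewrite mulr_ge0//; have := normr_ge0 t; lra.
(* Right of t only (t + h - s)^(d - 1) survives in [D], with integral h^d / d. *)
have h1 : (\int[mu]_(s in `[t, (t + h)%R[) `|D s * l s|%:E <=
    (C * (2 + `|t| + h) * (h `^ d / d))%:E)%E.
  apply: (@integral_le_scaled _ _ (fun s : R => pos_powR (t + h - s) (d - 1))) => //.
  - apply: measurable_funTS; apply: measurable_pos_powR.
    by apply: measurable_funB => //; exact: measurable_cst.
  - by move=> x _; exact: powR_ge0.
  - move=> x /=; rewrite in_itv/= => xt; rewrite normr_ge0/= normrM mulrC.
    rewrite DE (@pos_powR_le0E (t - x))//; last by lra.
    rewrite subr0 (ger0_norm (powR_ge0 _ _)) ler_wpM2r ?powR_ge0//.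
    by apply: lW; lra.
  have -> : (\int[mu]_(x in `[t, (t + h)%R[) (pos_powR (t + h - x) (d - 1))%:E =
      \int[mu]_(x in `[t, (t + h)%R[) ((t + h - x) `^ (d - 1))%:E)%E.
    apply: eq_integral => x; rewrite inE/= in_itv/= => xt.
    by rewrite pos_powR_gt0E//; lra.
  apply: (@integral_le_primitive_co _ (fun s : R => - (d^-1 * (t + h - s) `^ d))).
  - by lra.
  - move=> x xt; split; first exact: powR_ge0.
      have H := @is_derive_powR_refl (t + h) d x ltac:(lra).
      have := is_deriveN (is_deriveZ d^-1 H).
      have -> : - (d^-1 *: - (d * (t + h - x) `^ (d - 1))) = (t + h - x) `^ (d - 1).
        by rewrite scalerN opprK /GRing.scale/= mulrA mulVf ?mul1r// gt_eqF.
      by move=> K; exact: K.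
    by apply: continuous_powR_refl; lra.
  - move=> x xt; have -> : t + h - t = h by ring.
    by have := divr_ge0 (powR_ge0 (t + h - x) d) (ltW d0); rewrite mulrC; lra.
have h2 : (\int[mu]_(s in `[(t - 1)%R, t[) `|D s * l s|%:E <=
    (C * (2 + `|t| + h) * (h `^ d / d))%:E)%E.
  apply: (@integral_le_scaled _ _ (fun s : R => pos_powR (t - s) (d - 1)
     - pos_powR (t + h - s) (d - 1))) => //.
  - by apply: measurable_funTS; apply: measurable_funB; apply: measurable_pos_powR;
      apply: measurable_funB => //; exact: measurable_cst.
  - move=> x /=; rewrite in_itv/= => xt; rewrite !pos_powR_gt0E; try lra.
    have := @powR_sub_le d (t - x) h d01 ltac:(lra) (ltW h0).
    by have -> : t - x + h = t + h - x; [ring|case/andP].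
  - move=> x /=; rewrite in_itv/= => xt; rewrite normr_ge0/= normrM mulrC.
    rewrite DE !pos_powR_gt0E; try lra.
    have := @powR_sub_le d (t - x) h d01 ltac:(lra) (ltW h0).
    have -> : t - x + h = t + h - x by ring.
    case/andP => k0 _; rewrite distrC (ger0_norm k0) ler_wpM2r//.
    by apply: lW; lra.
  have -> : (\int[mu]_(x in `[(t - 1)%R, t[)
        (pos_powR (t - x) (d - 1) - pos_powR (t + h - x) (d - 1))%:E =
      \int[mu]_(x in `[(t - 1)%R, t[)
        ((t - x) `^ (d - 1) - (t + h - x) `^ (d - 1))%:E)%E.
    apply: eq_integral => x; rewrite inE/= in_itv/= => xt.
    by rewrite !pos_powR_gt0E//; lra.
  apply: (@integral_le_primitive_co _ (fun s : R => d^-1 * ((t + h - s) `^ d - (t - s) `^ d))).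
  - by lra.
  - move=> x xt; split.
    + have := @powR_sub_le d (t - x) h d01 ltac:(lra) (ltW h0).
      by have -> : t - x + h = t + h - x; [ring|case/andP].
    + have H := @is_derive_powR_refl (t + h) d x ltac:(lra).
      have H' := @is_derive_powR_refl t d x ltac:(lra).
      have := is_deriveZ d^-1 (is_deriveB H H').
      have -> : d^-1 *: (- (d * (t + h - x) `^ (d - 1)) - - (d * (t - x) `^ (d - 1)))
          = (t - x) `^ (d - 1) - (t + h - x) `^ (d - 1).
        by rewrite /GRing.scale/=; field; lra.
      by move=> K; exact: K.
    + by apply: cvgB; apply: continuous_powR_refl; lra.
  (* Subadditivity of the power d bounds the primitive at x by h^d / d, and its value at t - 1 is
     nonnegative. *)
  - move=> x xt; rewrite -mulrBr mulrC ler_wpM2r ?invr_ge0 ?(ltW d0)//.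
    have -> : t + h - (t - 1) = 1 + h by ring.
    have -> : t - (t - 1) = 1 by ring.
    have -> : t + h - x = (t - x) + h by ring.
    have := @powRD_le (t - x) h d ltac:(lra) (ltW h0) ltac:(lra).
    have : 1 `^ d <= (1 + h) `^ d by apply: ge0_ler_powR; rewrite ?nnegrE; lra.
    by rewrite powR1; lra.
have h3 : (\int[mu]_(s in `]-oo, (t - 1)%R[) `|D s * l s|%:E <=
    ((C * (2 + `|t| + h) * h) * (1 - d - b)^-1)%:E)%E.
  apply: (@integral_le_scaled _ _ (fun s : R => (t - s) `^ (d - 2 + b))) => //.
  - apply: measurable_funTS; apply: (measurableT_comp (measurable_powR _)).
    by apply: measurable_funB => //; exact: measurable_cst.
  - by rewrite mulr_ge0// ltW.
  - by move=> x _; exact: powR_ge0.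
  - move=> x /=; rewrite in_itv/= => xt; rewrite normr_ge0/= normrM.
    rewrite DE !pos_powR_gt0E; try lra.
    have := @powR_sub_le d (t - x) h d01 ltac:(lra) (ltW h0).
    have -> : t - x + h = t + h - x by ring.
    case/andP => k0 k1; rewrite distrC (ger0_norm k0).
    (* As t - x >= 1 here, 1 + |x| <= 1 + |t| + (t - x) <= (2 + |t|) (t - x). The path then
       contributes (t - x)^b, and the total exponent d - 2 + b is below -1. *)
    have lx : `|l x| <= C * ((2 + `|t| + h) * (t - x) `^ b).
      apply: (le_trans (lC x)); apply: ler_wpM2l => //.
      have tn := normr_ge0 t.
      apply: (@le_trans _ _ (((2 + `|t|) * (t - x)) `^ b)).
        apply: ge0_ler_powR; rewrite ?nnegrE; [lra|by rewrite addr_ge0| |].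
          by rewrite mulr_ge0//; lra.
        have : `|x| <= `|t| + (t - x).
          have -> : x = t - (t - x) by ring.
          rewrite (le_trans (ler_normB _ _))// lerD2l.
          by rewrite ger0_norm; lra.
        nra.
      rewrite powRM; [|lra|lra]; rewrite ler_wpM2r ?powR_ge0//.
      apply: (@le_trans _ _ (2 + `|t|)); last by lra.
      by apply: ler1_powR => //; lra.
    have -> : C * (2 + `|t| + h) * h * (t - x) `^ (d - 2 + b) =
       (h * (t - x) `^ (d - 2)) * (C * ((2 + `|t| + h) * (t - x) `^ b)).
      rewrite powRD; last by apply/implyP => _; rewrite subr_eq0 gt_eqF//; lra.
      by ring.
    exact: ler_pM.
  apply: (@le_trans _ _ (\int[mu]_(x in `]-oo, (t - 1)%R]) ((t - x) `^ (d - 2 + b))%:E)%E).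
    apply: ge0_subset_integral => //=.
    - apply: measurable_funTS; apply/measurable_EFinP.
      apply: (measurableT_comp (measurable_powR _)).
      by apply: measurable_funB => //; exact: measurable_cst.
    - by move=> x _; rewrite lee_fin powR_ge0.
    - by apply: subset_itvl; rewrite bnd_simp.
  apply: (@integral_le_primitive_Nyc _ (fun s : R => (1 - d - b)^-1 * (t - s) `^ (d - 1 + b))).
  - move=> x xt; split; first exact: powR_ge0.
      have H := @is_derive_powR_refl t (d - 1 + b) x ltac:(lra).
      have := is_deriveZ (1 - d - b)^-1 H.
      have -> : d - 1 + b - 1 = d - 2 + b by ring.
      rewrite /GRing.scale/=.
      suff -> : (1 - d - b)^-1 * - ((d - 1 + b) * (t - x) `^ (d - 2 + b)) =
        (t - x) `^ (d - 2 + b) by [].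
      by field; lra.
    by apply: continuous_powR_refl; lra.
  - move=> x xt; have -> : t - (t - 1) = 1 by ring.
    have : 0 <= (1 - d - b)^-1 * (t - x) `^ (d - 1 + b).
      by rewrite mulr_ge0 ?powR_ge0// invr_ge0; lra.
    by rewrite powR1 mulr1; lra.
have h4 : (\int[mu]_(s in `[(t + h)%R, +oo[) `|D s * l s|%:E = 0)%E.
  apply: integral0_eq => x /=; rewrite in_itv/= andbT => xt.
  by rewrite DE !pos_powR_le0E ?subrr ?mul0r ?normr0//; lra.
have mE : measurable_fun setT (fun s : R => `|D s * l s|%:E) by exact/measurable_EFinP.
have E0 s : (0 <= `|D s * l s|%:E)%E by rewrite lee_fin.
rewrite -set_itvNyy (@integral_itv_split _ _ (BLeft (t - 1)))//.
rewrite (@integral_itv_split _ (BLeft (t - 1)) (BLeft t) +oo%O)//; last first.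
  by rewrite bnd_simp; lra.
rewrite (@integral_itv_split _ (BLeft t) (BLeft (t + h)) +oo%O)//; last first.
  by rewrite bnd_simp; lra.
rewrite h4 adde0; apply: (le_trans (leeD h3 (leeD h2 h1))).
by rewrite -!EFinD lee_fin le_eqVlt; apply/orP; left; apply/eqP; ring.
Qed.
End kernel.

(** * Improper Riemann integrals as Lebesgue integrals *)

Section improper_integrals.
Context {R : realType}.
Notation mu := (@lebesgue_measure R).
Implicit Types (f : R -> R).

Lemma EFin_Rintegral (A : set R) f : measurable A ->
  mu.-integrable A (EFin \o f) ->
  ((\int[mu]_(x in A) f x)%:E = \int[mu]_(x in A) (f x)%:E)%E.
Proof. by move=> mA fi; rewrite fineK//; exact: integrable_fin_num. Qed.

Lemma le_normr_Rintegral_EFin (A : set R) f : measurable A ->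
  mu.-integrable A (EFin \o f) ->
  (`|\int[mu]_(x in A) f x|%:E <= \int[mu]_(x in A) `|f x|%:E)%E.
Proof.
move=> mA fi; rewrite -abse_EFin EFin_Rintegral//.
by apply: (le_trans (le_abse_integral _ _ _)) => //; exact: measurable_int fi.
Qed.

(** Dominated convergence sends the integrals of |f| over ]-oo, c - n] to 0 along integers;
    monotonicity in the domain then covers every real r below a suitable c - n. *)
Lemma cvg_RintegralNy f c : mu.-integrable `]-oo, c] (EFin \o f) ->
  \int[mu]_(x in `]-oo, r]) f x @[r --> -oo] --> 0.
Proof.
move=> fi; pose D : set R := `]-oo, c]%classic.
have mD : measurable D by exact: measurable_itv.
have mf : measurable_fun D f by apply/measurable_EFinP; exact: measurable_int fi.
pose fn n (x : R) := (`|f x| * \1_(`]-oo, (c - n%:R)]%classic : set R) x)%:E.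
have mfn n : measurable_fun D (fn n).
  apply/measurable_EFinP; apply: measurable_funM.
    exact: measurableT_comp.
  by apply: measurable_indic; exact: measurable_itv.
have [] := @dominated_convergence _ _ _ mu D mD fn (cst 0%E) (fun x => `|f x|%:E) mfn.
- exact: measurable_cst.
- apply: aeW => x _; apply: cvg_near_cst; near=> n.
  rewrite /fn indicE memNset ?mulr0//= in_itv/=; apply/negP.
  rewrite -ltNge ltrBlDr -ltrBlDl; near: n; exact: nbhs_infty_gtr.
- exact: (integrable_abse fi).
- apply: aeW => x n _; rewrite /fn abse_EFin lee_fin normrM normr_id.
  by rewrite ler_piMr// indicE; case: (_ \in _); rewrite ?normr1// normr0.
move=> _ _; rewrite integral0 => cv.
apply/cvgrPdist_le => /= e e0.
have [n nfin ne] : exists2 n, (\int[mu]_(x in D) fn n x)%E \is a fin_num &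
    (\int[mu]_(x in D) fn n x <= e%:E)%E.
  move: cv => /fine_cvgP[fin /cvgrPdist_le/(_ e e0) small].
  near \oo => n; exists n; first by near: n.
  have : `|0 - fine (\int[mu]_(x in D) fn n x)%E| <= e by near: n.
  rewrite sub0r normrN => /(le_trans (ler_norm _)).
  by rewrite -lee_fin fineK//; near: n.
near=> r.
have rc : r <= c - n%:R by near: r; apply: nbhs_ninfty_le; exact: num_real.
have rcD : `]-oo, c - n%:R]%classic `<=` D.
  by apply: subset_itvl; rewrite bnd_simp lerBlDr lerDl.
have rD : `]-oo, r]%classic `<=` `]-oo, c - n%:R]%classic by apply: subset_itvl.
have mnf (A : set R) : measurable A -> A `<=` D ->
    measurable_fun A (fun x => `|f x|%:E).
  move=> mA AD; apply/measurable_EFinP; apply: measurableT_comp => //.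
  exact: measurable_funS mf.
rewrite sub0r normrN -lee_fin.
apply: (le_trans (le_normr_Rintegral_EFin _ _)) => //.
  by apply: integrableS fi => //; exact: subset_trans rcD.
apply: le_trans ne.
apply: (@le_trans _ _ (\int[mu]_(x in `]-oo, (c - n%:R)%R]) `|f x|%:E)%E).
  by apply: ge0_subset_integral => //; exact: mnf.
have -> : (\int[mu]_(x in `]-oo, (c - n%:R)%R]) `|f x|%:E =
    \int[mu]_(x in `]-oo, (c - n%:R)%R]) fn n x)%E.
  by apply: eq_integral => x xn; rewrite /fn indicE xn mulr1.
have fn0 x : D x -> (0 <= fn n x)%E by move=> _; rewrite lee_fin mulr_ge0// indicE.
by apply: ge0_subset_integral => //; exact: mfn.
Unshelve. all: by end_near. Qed.

Lemma cumul_continuous f : mu.-integrable setT (EFin \o f) ->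
  continuous (fun r => \int[mu]_(x in `]-oo, r]) f x).
Proof.
move=> fi x; pose a := x - 1; pose b := x + 1.
have fiA (i : interval R) : mu.-integrable [set` i] (EFin \o f).
  by apply: integrableS fi => //; exact: measurable_itv.
have ab : a < b by rewrite /a /b; lra.
have xab : x \in `]a, b[ by rewrite in_itv/= /a /b; lra.
have cI : {for x, continuous ((parameterized_integral mu a)^~ f)}.
  apply: (within_continuous_continuous ab _ xab).
  apply: parameterized_integral_continuous; [exact: (ltW ab)|exact: fiA].
have E : \forall y \near x, \int[mu]_(z in `]-oo, y]) f z =
    \int[mu]_(z in `]-oo, a]) f z + parameterized_integral mu a y f.
  near=> y; have ay : a <= y.
    near: y; apply/nbhs_ballP; exists 1 => //= z; rewrite /ball /= ltr_norml.
    by rewrite /a; lra.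
  rewrite /parameterized_integral -(@Rintegral_itv_obnd_cbnd _ a (BRight y) f);
    last exact: (fiA `]a, y]).
  have ayB : (BRight a <= BRight y)%O by rewrite bnd_simp.
  rewrite -(@Rintegral_itvB _ f -oo%O (BRight y) a (fiA `]-oo, y]) isT ayB).
  by rewrite addrC subrK.
rewrite /continuous_at (nbhs_singleton E).
apply: cvg_trans.
  apply: near_eq_cvg; near=> y; apply/esym; near: y; exact: E.
by apply: cvgD => //; exact: cvg_cst.
Unshelve. all: by end_near. Qed.

Global Instance from_right_filter (p : \bar R) : ProperFilter (from_right p).
Proof. by case: p => [r||] /=; exact: _. Qed.

Global Instance from_left_filter (p : \bar R) : ProperFilter (from_left p).
Proof. by case: p => [r||] /=; exact: _. Qed.

Lemma near_from_right (p : \bar R) c : (p < c%:E)%E ->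
  \forall u \near from_right p, (p < u%:E)%E /\ u < c.
Proof.
case: p => [r||] //=; first rewrite lte_fin => rc.
  near=> u; rewrite lte_fin; split; near: u.
    exact: nbhs_right_gt.
  exact: nbhs_right_lt.
move=> _; near=> u; split; first exact: ltNyr.
by near: u; apply: nbhs_ninfty_lt; exact: num_real.
Unshelve. all: by end_near. Qed.

Lemma near_from_left (p : \bar R) c : (c%:E < p)%E ->
  \forall u \near from_left p, (u%:E < p)%E /\ c < u.
Proof.
case: p => [r||] //=; first rewrite lte_fin => rc.
  near=> u; rewrite lte_fin; split; near: u.
    exact: nbhs_left_lt.
  exact: nbhs_left_gt.
move=> _; near=> u; split; first exact: ltry.
by near: u; apply: nbhs_pinfty_gt; exact: num_real.
Unshelve. all: by end_near. Qed.

Lemma exists_real_between (p q : \bar R) : (p < q)%E ->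
  exists c : R, (p < c%:E)%E /\ (c%:E < q)%E.
Proof.
case: p q => [p||] [q||] //=.
- by rewrite lte_fin => pq; exists ((p + q) / 2); rewrite !lte_fin; split; lra.
- by move=> _; exists (p + 1); rewrite lte_fin ltry; split=> //; lra.
- by move=> _; exists (q - 1); rewrite lte_fin ltNyr; split=> //; lra.
- by move=> _; exists 0; rewrite ltNyr ltry.
Qed.

Lemma is_improper_Riemann_unique f p q :
  is_subset1 [set I | is_improper_Riemann f p q I].
Proof. by move=> I J [_ HI] [_]; exact: cvg_unique HI. Qed.

Lemma improper_RiemannE f Phi p q A B : (p < q)%E ->
  (forall u v, (p < u%:E)%E -> u <= v -> (v%:E < q)%E ->
     is_RS f id u v (Phi v - Phi u)) ->
  Phi x @[x --> from_right p] --> A -> Phi x @[x --> from_left q] --> B ->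
  improper_Riemann f p q = B - A.
Proof.
move=> pq HRS PA PB.
apply: (xget_subset1 0 _ (@is_improper_Riemann_unique f p q)).
split=> [u v pu uv vq|]; first by exists (Phi v - Phi u); exact: HRS.
(* The two ends move independently; a point [c] between them keeps them ordered, since eventually u
   < c < v. *)
have [c [pc cq]] := exists_real_between pq.
apply: (@cvg_trans _ ((Phi uv.2 - Phi uv.1)
    @[uv --> (from_right p, from_left q)])).
  apply: near_eq_cvg.
  exists ([set u | (p < u%:E)%E /\ u < c], [set v | (v%:E < q)%E /\ c < v]).
    by split; [exact: near_from_right|exact: near_from_left].
  move=> [u v] /= [[pu uc] [vq cv]]; apply/esym/proper_RSE/HRS => //.
  by rewrite ltW// (lt_trans uc).
pose FF := filter_prod (from_right p) (from_left q).
have c2 : Phi uv.2 @[uv --> FF] --> B by apply: cvg_comp PB; exact: cvg_snd.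
have c1 : Phi uv.1 @[uv --> FF] --> A by apply: cvg_comp PA; exact: cvg_fst.
exact: (cvgB c2 c1).
Qed.

(* Near (x^'+, x^'-) the left endpoint exceeds the right one, so that [proper_RS]
   takes its default value 0. *)
Lemma improper_Riemann_diag f x : improper_Riemann f x%:E x%:E = 0.
Proof.
apply: (xget_subset1 0 _ (@is_improper_Riemann_unique f x%:E x%:E)).
split=> [u v|].
  rewrite !lte_fin => xu uv vx.
  by have := lt_le_trans xu uv; rewrite ltNge (ltW vx).
apply: cvg_near_cst.
exists ([set u | x < u], [set v | v < x]) => /=.
  by split; [exact: nbhs_right_gt|exact: nbhs_left_lt].
move=> [u v] /= [xu vx]; apply: xgetPN => I [].
by rewrite leNgt (lt_trans vx).
Qed.

End improper_integrals.

(** * Paths of fractional processes *)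

Section FLP_paths.
Context {R : realType}.
Notation mu := (@lebesgue_measure R).

Lemma continuous_pos_powR_refl (c r x : R) : r != 0 -> x != c ->
  {for x, continuous (fun s => pos_powR (c - s) r)}.
Proof.
move=> r0 xc.
suff : pos_powR (c - s) r @[s --> x] --> pos_powR (c - x) r by [].
have [{}xc|cx|/eqP] := ltgtP x c; last by rewrite (negbTE xc).
  rewrite pos_powR_gt0E ?subr_gt0//.
  apply: cvg_trans (@continuous_powR_refl R c r x xc).
  apply: near_eq_cvg; near=> s; rewrite pos_powR_gt0E// subr_gt0.
  by near: s; exact: lt_nbhsl.
rewrite pos_powR_le0E// ?subr_le0 ?ltW//; apply: cvg_near_cst; near=> s.
rewrite pos_powR_le0E// subr_le0 ltW//; near: s.
apply/nbhs_ballP; exists (x - c) => /=; first by rewrite subr_gt0.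
by move=> z; rewrite /ball/= ltr_norml; lra.
Unshelve. all: by end_near. Qed.

Lemma continuous_FLP_kernel (d t x : R) : d < 1 -> x != 0 -> x != t ->
  {for x, continuous (FLP_kernel d t)}.
Proof.
move=> d1 x0 xt; have dN0 : d - 1 != 0 by rewrite subr_eq0 lt_eqF.
apply: cvgB; first exact: continuous_pos_powR_refl.
have := @continuous_pos_powR_refl 0 (d - 1) x dN0 x0.
have -> : (fun s => pos_powR (0 - s) (d - 1)) = (fun s => pos_powR (- s) (d - 1)).
  by apply/funext => s; rewrite sub0r.
exact.
Qed.

Lemma one_sided_limitsM (f g : R -> R) x : {for x, continuous f} ->
  one_sided_limits g x -> one_sided_limits (fun s => f s * g s) x.
Proof.
move=> cf [gr gl]; split; apply: is_cvgM => //; apply/cvg_ex; exists (f x).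
  exact: cvg_at_right_filter.
exact: cvg_at_left_filter.
Qed.

Section path.
Variables (d b C : R) (l : R -> R).

(** The interface between probability and analysis: all that the pathwise arguments use of a path.
    In the application [b] depends on [d] alone, while [C] varies with the path. *)
Definition tame_path := [/\ 0 < d < 1, 0 < b, b < 1 - d, 0 <= C &
  (forall s, one_sided_limits l s) /\ (forall s, `|l s| <= C * (1 + `|s|) `^ b)].

Definition FLP_integral t := \int[mu]_s (FLP_kernel d t s * l s).

(** It tends to 0 with [h], which gives continuity; at h = |t| it is of quadratic order in |t|,
    which gives growth. *)
Definition FLP_increment_bound (t h : R) :=
  C * (2 + `|t| + h) * (2 * (h `^ d / d) + h / (1 - d - b)).

Lemma FLP_kernel0 s : FLP_kernel d 0 s = 0.
Proof. by rewrite /FLP_kernel sub0r subrr. Qed.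

Lemma tame_path_measurable : tame_path -> measurable_fun setT l.
Proof. by move=> [_ _ _ _ [? _]]; exact: regulated_measurable. Qed.

Lemma measurable_FLP_integrand t : tame_path ->
  measurable_fun setT (fun s => FLP_kernel d t s * l s).
Proof.
move=> tl; apply: measurable_funM; first exact: measurable_FLP_kernel.
exact: tame_path_measurable.
Qed.

Lemma integral_FLP_increment_le t h : tame_path -> 0 < h ->
  (\int[mu]_(s in [set: R]) `|(FLP_kernel d (t + h) s - FLP_kernel d t s) * l s|%:E <=
  (FLP_increment_bound t h)%:E)%E.
Proof.
move=> tl h0; have [d01 b0 bd C0 [_ lC]] := tl.
by apply: integral_kernel_diff_le => //; exact: tame_path_measurable.
Qed.

(** Since the kernel vanishes at time 0, the integrand is an increment from 0 to t, or for negative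
    t minus the increment from t to 0. *)
Lemma integrable_FLP_integrand t : tame_path ->
  mu.-integrable setT (EFin \o (fun s => FLP_kernel d t s * l s)).
Proof.
move=> tl; apply/integrableP; split.
  by apply/measurable_EFinP; exact: measurable_FLP_integrand.
have [t0|t0|<-] := ltgtP 0 t; last first.
- under eq_integral do rewrite /= FLP_kernel0 mul0r normr0.
  by rewrite integral0 ltry.
- have := @integral_FLP_increment_le t (- t) tl ltac:(lra).
  move/le_lt_trans => /(_ _ (ltry _)); apply: le_lt_trans.
  rewrite le_eqVlt; apply/orP; left; apply/eqP; apply: eq_integral => s _ /=.
  by rewrite subrr FLP_kernel0 sub0r mulNr normrN.
- have := @integral_FLP_increment_le 0 t tl t0.
  move/le_lt_trans => /(_ _ (ltry _)); apply: le_lt_trans.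
  rewrite le_eqVlt; apply/orP; left; apply/eqP; apply: eq_integral => s _ /=.
  by rewrite add0r FLP_kernel0 subr0.
Qed.

Lemma FLP_integral_increment_le t h : tame_path -> 0 < h ->
  `|FLP_integral (t + h) - FLP_integral t| <= FLP_increment_bound t h.
Proof.
move=> tl h0; rewrite /FLP_integral -RintegralB//.
- rewrite -lee_fin; apply: le_trans (integral_FLP_increment_le t tl h0).
  under eq_Rintegral do rewrite -mulrBl.
  apply: le_normr_Rintegral_EFin => //.
  apply: eq_integrable (integrableB _ (integrable_FLP_integrand (t + h) tl)
    (integrable_FLP_integrand t tl)) => // s _ /=.
  by rewrite mulrBl.
- exact: integrable_FLP_integrand.
- exact: integrable_FLP_integrand.
Qed.

Lemma FLP_integral0 : FLP_integral 0 = 0.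
Proof.
rewrite /FLP_integral; under eq_Rintegral do rewrite FLP_kernel0 mul0r.
by rewrite Rintegral_cst// mul0r.
Qed.

(** One factor 1 + |t| comes from the size of the path, the other from the kernel, where h^d is
    crudely replaced by 1 + h. *)
Lemma FLP_integral_growth : tame_path -> exists2 K, 0 <= K &
  forall t, t <= 0 -> `|FLP_integral t| <= K * (1 + `|t|) ^+ 2.
Proof.
move=> tl; have [/andP[d0 d1] b0 bd C0 _] := tl.
have e0 : 0 < (1 - d - b)^-1 by rewrite invr_gt0; lra.
have f0 : 0 < d^-1 by rewrite invr_gt0.
exists (C * 2 * (2 * d^-1 + (1 - d - b)^-1)).
  by rewrite !mulr_ge0//; lra.
move=> t; rewrite le_eqVlt => /predU1P[->|t0].
  by rewrite FLP_integral0 normr0 mulr_ge0 ?sqr_ge0// !mulr_ge0//; lra.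
have := @FLP_integral_increment_le t (- t) tl ltac:(lra).
rewrite (subrr t) FLP_integral0 sub0r normrN => inc; apply: (le_trans inc).
have -> : - t = `|t| by rewrite ltr0_norm.
rewrite /FLP_increment_bound.
have h0 : 0 <= `|t| by [].
move: (`|t| : R) h0 => {t0}h h0.
have hd : h `^ d <= 1 + h.
  apply: (@le_trans _ _ ((1 + h) `^ d)).
    by apply: ge0_ler_powR; rewrite ?nnegrE; lra.
  by apply: ler1_powR; lra.
have h1 : h `^ d / d <= (1 + h) / d by rewrite ler_wpM2r// ltW.
have h2 : h / (1 - d - b) <= (1 + h) / (1 - d - b).
  by rewrite ler_wpM2r ?(ltW e0)//; lra.
apply: (@le_trans _ _ (C * (2 * (1 + h)) *
  (2 * ((1 + h) / d) + (1 + h) / (1 - d - b)))).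
  apply: ler_pM; [|..|lra].
  - by rewrite mulr_ge0//; lra.
  - by rewrite addr_ge0// ?mulr_ge0// ?powR_ge0// ltW.
  - by rewrite ler_wpM2l//; lra.
by rewrite le_eqVlt; apply/orP; left; apply/eqP; ring.
Qed.

Lemma FLP_integral_continuous : tame_path -> continuous FLP_integral.
Proof.
move=> tl t; have [/andP[d0 d1] b0 bd C0 _] := tl.
have e0 : 0 < (1 - d - b)^-1 by rewrite invr_gt0; lra.
(* For s < t the increment starts at [s] instead of [t], so the bound must be uniform in the base
   point: 2 + |s| + h <= 4 + |t| when |s| <= |t| + 1 and h <= 1. *)
pose W := C * (4 + `|t|).
have W0 : 0 <= W by rewrite mulr_ge0//; have := normr_ge0 t; lra.
pose B h := W * (2 * (h `^ d / d) + h / (1 - d - b)).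
have B0 : B h @[h --> 0^'+] --> 0.
  have c1 : h @[h --> (0 : R)^'+] --> (0 : R) by apply: cvg_at_right_filter; exact: cvg_id.
  have := (cvgM (cvg_cst W) (cvgD (cvgM (cvg_cst (2 : R))
    (cvgM (powR_cvg0 d0) (cvg_cst d^-1))) (cvgM c1 (cvg_cst (1 - d - b)^-1)))).
  by rewrite !mul0r !(mulr0, addr0); exact.
have HB s h : 0 < h -> h <= 1 -> `|s| <= `|t| + 1 ->
    FLP_increment_bound s h <= B h.
  move=> h0 h1 st; rewrite /FLP_increment_bound /B /W ler_wpM2r//.
    by rewrite addr_ge0 ?mulr_ge0 ?powR_ge0 ?invr_ge0 ?(ltW d0) ?(ltW h0)//; lra.
  by rewrite ler_wpM2l//; lra.
apply/cvgrPdist_le => /= e ep.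
move/cvgrPdist_le : B0 => /(_ e ep)/nbhs_ballP[r /= r0 Hr].
have {}Hr h : 0 < h -> h < r -> B h <= e.
  move=> h0 hr; have := Hr h; rewrite /ball/= sub0r normrN gtr0_norm//.
  move=> /(_ hr h0); rewrite sub0r normrN; exact: le_trans (ler_norm _).
apply/nbhs_ballP; exists (Num.min r 1) => /=; first by rewrite lt_min r0 ltr01.
move=> s; rewrite /ball /= lt_min => /andP[sr s1].
have [ts|st|->] := ltgtP t s; last by rewrite subrr normr0 ltW.
- have E : s - t = `|t - s| by rewrite ltr0_norm; lra.
  have h0 : 0 < s - t by lra.
  have := @FLP_integral_increment_le t (s - t) tl h0.
  rewrite (subrKC t s) => inc; rewrite distrC; apply: (le_trans inc).
  apply: (@le_trans _ _ (B (s - t))); first by apply: HB; lra.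
  by apply: Hr; lra.
- have E : t - s = `|t - s| by rewrite gtr0_norm; lra.
  have h0 : 0 < t - s by lra.
  have := @FLP_integral_increment_le s (t - s) tl h0.
  rewrite (subrKC s t) => inc; apply: (le_trans inc).
  apply: (@le_trans _ _ (B (t - s))); last by apply: Hr; lra.
  apply: HB; [lra|lra|].
  have -> : s = t - (t - s) by ring.
  by rewrite (le_trans (ler_normB _ _))//; lra.
Qed.

(** The cumulative integral [Phi] is continuous, hence crosses the singularities at 0 and t, and the
    three improper integrals telescope to [Phi M]. Beyond [M] the kernel vanishes, so this is the
    integral over the whole line. *)
Lemma FLP_integralE (T : Type) (L : R -> T -> R) w t : tame_path ->
  L ^~ w = l -> FLP d L t w = (Gamma d)^-1 * FLP_integral t.
Proof.
move=> tl Ll; have [/andP[d0 d1] b0 bd C0 [llim _]] := tl.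
have dN0 : d - 1 != 0 by rewrite subr_eq0 lt_eqF.
pose f s := FLP_kernel d t s * l s.
have fE : FLP_integrand d L t w = f by rewrite /f -Ll.
have fi : mu.-integrable setT (EFin \o f) by exact: integrable_FLP_integrand.
have fiA (i : interval R) : mu.-integrable [set` i] (EFin \o f).
  by apply: integrableS fi => //; exact: measurable_itv.
pose Phi r := \int[mu]_(x in `]-oo, r]) f x.
have cPhi : continuous Phi by exact: cumul_continuous.
have PhiB p q : p <= q -> Phi q - Phi p = \int[mu]_(x in `]p, q]) f x.
  move=> pq; have pqB : (BRight p <= BRight q)%O by rewrite bnd_simp.
  by rewrite -(@Rintegral_itvB _ f -oo%O (BRight q) p (fiA `]-oo, q]) isT pqB).
have RS u v : u <= v -> (forall x, u <= x <= v -> x != 0 /\ x != t) ->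
    is_RS f id u v (Phi v - Phi u).
  move=> uv H; apply: is_RS_regulated => //; last by move=> p q _ pq _; exact: PhiB.
  move=> x /H[x0 xt]; apply: one_sided_limitsM => //.
  exact: continuous_FLP_kernel.
pose m := Num.min 0 t; pose M := Num.max 0 t.
have mM : m <= M by rewrite /m /M; case: (leP 0 t) => //; exact: ltW.
have m0 x : x < m -> x != 0 /\ x != t.
  by rewrite /m lt_min => /andP[? ?]; rewrite !lt_eqF.
have M0 x : M < x -> x != 0 /\ x != t.
  by rewrite /M gt_max => /andP[? ?]; rewrite !gt_eqF.
have mM0 x : m < x -> x < M -> x != 0 /\ x != t.
  rewrite /m /M; case: (leP 0 t) => t0 h1 h2.
    by rewrite gt_eqF// lt_eqF.
  by rewrite lt_eqF// gt_eqF.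
have fM x : M < x -> f x = 0.
  rewrite /M gt_max => /andP[x0 xt].
  rewrite /f /FLP_kernel !pos_powR_le0E ?subrr ?mul0r//.
    by rewrite oppr_le0 ltW.
  by rewrite subr_le0 ltW.
have PhiM x : M <= x -> Phi x = Phi M.
  move=> Mx; apply/eqP; rewrite -subr_eq0 PhiB//; apply/eqP.
  rewrite /Rintegral integral0_eq//= => y; rewrite in_itv/= => /andP[My _].
  by rewrite fM.
have I1 : improper_Riemann f -oo%E m%:E = Phi m - 0.
  apply: (@improper_RiemannE _ f Phi) => //.
  - by rewrite ltNyr.
  - move=> u v _ uv; rewrite lte_fin => vm; apply: RS => // x /andP[_ xv].
    exact/m0/(le_lt_trans xv).
  - exact: cvg_RintegralNy (fiA `]-oo, 0%R]).
  - by apply: cvg_at_left_filter; exact: cPhi.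
have I2 : improper_Riemann f m%:E M%:E = Phi M - Phi m.
  (* For t = 0 the middle interval is empty, and its integral is the degenerate value 0. *)
  move: mM; rewrite le_eqVlt => /predU1P[->|mlM].
    by rewrite improper_Riemann_diag subrr.
  apply: (@improper_RiemannE _ f Phi) => //.
  - move=> u v; rewrite !lte_fin => mu_ uv vM; apply: RS => // x /andP[ux xv].
    by apply: mM0; [exact: lt_le_trans ux|exact: le_lt_trans vM].
  - by apply: cvg_at_right_filter; exact: cPhi.
  - by apply: cvg_at_left_filter; exact: cPhi.
have I3 : improper_Riemann f M%:E +oo%E = Phi M - Phi M.
  apply: (@improper_RiemannE _ f Phi) => //.
  - by rewrite ltry.
  - move=> u v; rewrite lte_fin => Mu uv _; apply: RS => // x /andP[ux _].
    exact/M0/(lt_le_trans Mu).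
  - by apply: cvg_at_right_filter; exact: cPhi.
  - apply: cvg_near_cst; near=> x; apply: PhiM.
    by near: x; apply: nbhs_pinfty_ge; exact: num_real.
rewrite /FLP fE -/m -/M I1 I2 I3; congr (_ * _).
have -> : Phi m - 0 + (Phi M - Phi m) + (Phi M - Phi M) = Phi M by ring.
rewrite /FLP_integral -/f -set_itvNyy.
have MB : (BRight M <= +oo)%O by [].
have := @Rintegral_itvB _ f -oo%O +oo%O M (fiA `]-oo, +oo[) isT MB.
rewrite [X in _ = X]/Rintegral integral0_eq/=; last first.
  by move=> y; rewrite in_itv/= andbT => /fM ->.
by move/eqP; rewrite subr_eq0 => /eqP ->.
Unshelve. all: by end_near. Qed.
End path.
End FLP_paths.

(** * Integrals of exponential functions *)

Section exponential_weight.
Context {R : realType}.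
Notation mu := (@lebesgue_measure R).

Lemma is_derive_expRZ (k x : R) :
  is_derive x 1 (fun s => expR (k * s)) (k * expR (k * x)).
Proof.
have d1 := is_derive_expR (k * x).
have d2 : is_derive x 1 (fun s : R => k * s) k.
  by have := is_deriveZ k (is_derive_id x 1); rewrite /GRing.scale/= mulr1.
have := @is_derive1_comp R expR (fun s => k * s) x _ _ d1 d2.
by rewrite mulrC.
Qed.

Lemma continuous_expRZ (k : R) : continuous (fun s : R => expR (k * s)).
Proof. exact: (is_derive_continuous (is_derive_expRZ k)). Qed.

Lemma square_le_expR (lambda C s : R) (g : R -> R) : 0 < lambda -> s <= 0 ->
  `|g s| <= C * (1 + `|s|) ^+ 2 ->
  `|g s * expR (lambda * s)| <=
  C * (1 + 4 / lambda) ^+ 2 * expR (lambda / 2 * s).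
Proof.
move=> l0 s0 gC.
have C0 : 0 <= C.
  have := le_trans (normr_ge0 _) gC.
  by rewrite pmulr_lge0// exprn_gt0// ltr_pwDl.
have k0 : 0 < 4 / lambda by rewrite divr_gt0.
(* A quarter of the exponent bounds 1 + |s| up to a constant, so its square uses up half of the
   weight and leaves e^(lambda s / 2). *)
pose y := lambda * - s / 4.
have ns : `|s| = - s by rewrite ler0_norm.
have y0 : 0 <= y by rewrite /y divr_ge0// mulr_ge0 ?oppr_ge0// ltW.
have h1 : 1 + `|s| <= (1 + 4 / lambda) * expR y.
  apply: (@le_trans _ _ ((1 + 4 / lambda) * (1 + y))).
    have : 4 / lambda * y = - s by rewrite /y; field; lra.
    by rewrite ns; nra.
  by apply: ler_wpM2l; [lra|exact: expR_ge1Dx].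
have h2 : (1 + `|s|) ^+ 2 <= ((1 + 4 / lambda) * expR y) ^+ 2.
  by rewrite lerXn2r// nnegrE; [rewrite addr_ge0|rewrite mulr_ge0 ?expR_ge0//; lra].
rewrite normrM (ger0_norm (expR_ge0 _)).
apply: (@le_trans _ _ (C * ((1 + 4 / lambda) * expR y) ^+ 2 * expR (lambda * s))).
  rewrite ler_wpM2r ?expR_ge0//; apply: (le_trans gC); exact: ler_wpM2l.
have -> : expR (lambda / 2 * s) = expR y ^+ 2 * expR (lambda * s).
  by rewrite expr2 -!expRD; congr expR; rewrite /y; field.
by rewrite exprMn !mulrA.
Qed.

Lemma cvg_expRNy (f : R -> R) (K m : R) : 0 < m ->
  (forall s, s <= 0 -> `|f s| <= K * expR (m * s)) -> f r @[r --> -oo] --> 0.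
Proof.
move=> m0 H; have K0 : 0 <= K.
  by have := H 0 (lexx _); rewrite mulr0 expR0 mulr1; apply: le_trans.
apply/cvgrPdist_le => /= e e0; near=> r.
have r0 : r <= 0 by near: r; apply: nbhs_ninfty_le; exact: num_real.
have rl : r <= ln (e / (K + 1)) / m.
  by near: r; apply: nbhs_ninfty_le; exact: num_real.
have eK : 0 < e / (K + 1) by rewrite divr_gt0//; lra.
rewrite sub0r normrN; apply: (le_trans (H r r0)).
have : expR (m * r) <= e / (K + 1).
  by rewrite -[leRHS]lnK ?posrE// ler_expR mulrC -ler_pdivlMr.
have h : (e / (K + 1)) * (K + 1) = e by field; lra.
have := expR_ge0 (m * r); nra.
Unshelve. all: by end_near. Qed.

Lemma integrable_exp_dominated (h : R -> R) (K m y : R) : 0 < m -> continuous h ->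
  (forall s, s <= 0 -> `|h s| <= K * expR (m * s)) ->
  mu.-integrable `]-oo, y] (EFin \o h).
Proof.
move=> m0 ch H; have K0 : 0 <= K.
  by have := H 0 (lexx _); rewrite mulr0 expR0 mulr1; apply: le_trans.
have mh : measurable_fun setT h by exact: continuous_measurable_fun.
have mE : measurable_fun setT (fun x => `|h x|%:E).
  by apply/measurable_EFinP; exact: measurableT_comp.
have fin0 : (\int[mu]_(x in `]-oo, 0%R]) `|h x|%:E <= (K * m^-1)%:E)%E.
  apply: (@integral_le_scaled _ _ _ (fun x => expR (m * x))) => //.
  - exact/measurable_EFinP/measurable_funTS.
  - by apply: measurable_funTS; apply: continuous_measurable_fun; exact: continuous_expRZ.
  - by move=> x /=; rewrite in_itv/= => x0; rewrite normr_ge0/= H.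
  apply: (@integral_le_primitive_Nyc _ _ (fun x => m^-1 * expR (m * x))).
    move=> x _; split; [exact: expR_ge0| |exact: continuous_expRZ].
    have := is_deriveZ m^-1 (is_derive_expRZ m x).
    by rewrite /GRing.scale/= mulrA mulVf ?mul1r ?gt_eqF// => K1; exact: K1.
  move=> x _; rewrite mulr0 expR0 mulr1 lerBlDr lerDl mulr_ge0 ?expR_ge0//.
  by rewrite invr_ge0 ltW.
have int0 : mu.-integrable `]-oo, 0%R] (EFin \o h).
  apply/integrableP; split; first exact/measurable_EFinP/measurable_funTS.
  by apply: (le_lt_trans fin0); rewrite ltry.
have [y0|y0] := leP y 0.
  by apply: integrableS int0 => //; apply: subset_itvl; rewrite bnd_simp.
have inty : mu.-integrable `[0%R, y] (EFin \o h).
  apply: continuous_compact_integrable; first exact: segment_compact.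
  exact: continuous_subspaceT.
apply/integrableP; split; first exact/measurable_EFinP/measurable_funTS.
rewrite (@integral_itv_split _ _ _ (BRight 0))//.
  apply: lte_add_pinfty; first by move/integrableP : int0 => [].
  move/integrableP : inty => [_]; apply: le_lt_trans.
  apply: ge0_subset_integral => //; first exact: measurable_funTS.
  by apply: subset_itvr; rewrite bnd_simp.
by rewrite bnd_simp ltW.
Qed.

(** The deterministic core: both integrals are increments of explicit functions, [Phi] for the
    Stieltjes one and [G] for the Riemann one, and continuity in t is that of [Phi]. *)
Lemma RS_expR_continuous_path (lambda C : R) (g : R -> R) (a : \bar R) :
  0 < lambda -> continuous g ->
  (forall s, s <= 0 -> `|g s| <= C * (1 + `|s|) ^+ 2) -> (a < +oo)%E ->
  let E := fun s : R => expR (lambda * s) in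
  [/\ a = -oo%E -> E r * g r @[r --> -oo] --> 0,
      (forall t : R, (a < t%:E)%E ->
        [/\ RS_integrable E g a t,
            RS_integrable (fun s => g s * E s) id a t &
            RS_integral E g a t =
              E t * g t
              - (match a with r%:E => E r * g r | _ => 0 end)
              - lambda * RS_integral (fun s => g s * E s) id a t]) &
      {in [set t : R | (a < t%:E)%E],
        continuous (fun t => RS_integral E g a t)}].
Proof.
move=> l0 cg gC ay E.
pose h s := g s * E s.
have cE : continuous E by exact: continuous_expRZ.
have ch : continuous h by move=> x; apply: cvgM; [exact: cg|exact: cE].
have l20 : 0 < lambda / 2 by rewrite divr_gt0.
have hK s : s <= 0 -> `|h s| <= C * (1 + 4 / lambda) ^+ 2 * expR (lambda / 2 * s).
  by move=> s0; apply: square_le_expR => //; exact: gC.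
have hi y : mu.-integrable `]-oo, y] (EFin \o h).
  exact: integrable_exp_dominated l20 ch hK.
(* Anchored at -oo, this primitive tends to 0 there and so serves real and infinite [a] alike. *)
pose G x := \int[mu]_(s in `]-oo, x]) h s.
have dG (x : R) : is_derive x 1 G (h x).
  have [|||dG <-] := @continuous_FTC1 R h -oo%O x (x + 1) _ (hi _).
  - by rewrite ltrDl.
  - by rewrite ltNyr.
  - exact: ch.
  by split; [exact: dG|rewrite derive1E].
have G0 : G r @[r --> -oo] --> 0 by exact: cvg_RintegralNy (hi 0).
have h0 : h r @[r --> -oo] --> 0 by exact: cvg_expRNy hK.
pose Phi x := E x * g x - lambda * G x.
have RS1 u t : u <= t -> is_RS E g u t (Phi t - Phi u).
  move=> ut; apply: (@is_RS_by_parts R E (fun x => lambda * E x) g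
    (fun x => lambda * G x)) => //.
  - by move=> x; apply: cvgM; [exact: cvg_cst|exact: cE].
  - by move=> x; exact: is_derive_expRZ.
  - move=> x; have := is_deriveZ lambda (dG x).
    by rewrite /GRing.scale/= /h mulrCA => K1; exact: K1.
have RS2 u t : u <= t -> is_RS h id u t (G t - G u).
  by move=> ut; exact: is_RS_primitive.
have Eg0 : E r * g r @[r --> -oo] --> 0.
  by under eq_fun do rewrite mulrC; exact: h0.
have Phi0 : Phi r @[r --> -oo] --> 0.
  have -> : 0 = 0 - lambda * 0 :> R by rewrite mulr0 subr0.
  by apply: cvgB => //; apply: cvgM => //; exact: cvg_cst.
have int1 t : (a < t%:E)%E -> is_RS_from E g a t
    (Phi t - (match a with r%:E => Phi r | _ => 0 end)).
  by move=> at_; apply: is_RS_from_primitive => // u; exact: RS1.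
have int2 t : (a < t%:E)%E -> is_RS_from h id a t
    (G t - (match a with r%:E => G r | _ => 0 end)).
  by move=> at_; apply: is_RS_from_primitive => // u; exact: RS2.
split=> [_ //|t at_|t].
  split; [by eexists; exact: int1|by eexists; exact: int2|].
  rewrite (RS_integralE (int1 t at_)) (RS_integralE (int2 t at_)) /Phi.
  by case: (a) => [r||]; ring.
rewrite inE /= => at_.
have near_a : \forall x \near t, (a < x%:E)%E.
  move: at_; case: (a) => [r||]; rewrite ?lte_fin.
  - move=> rt; apply/nbhs_ballP; exists (t - r) => /=; first by rewrite subr_gt0.
    by move=> x; rewrite /ball/= ltr_norml lte_fin; lra.
  - by [].
  - by move=> _; exists 1 => //= x _; rewrite ltNyr.
rewrite /continuous_at (RS_integralE (int1 t at_)).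
apply: (@cvg_trans _ ((Phi x - (match a with r%:E => Phi r | _ => 0 end)) @[x --> t])).
  apply: near_eq_cvg; near=> x; apply/esym/RS_integralE/int1.
  by near: x.
have cG : {for t, continuous G} by exact: (is_derive_continuous dG).
have cPhi : {for t, continuous Phi}.
  exact: (cvgB (cvgM (cE t) (cg t)) (cvgM (cvg_cst _) cG)).
exact: (cvgB cPhi (cvg_cst _)).
Unshelve. all: by end_near. Qed.
End exponential_weight.

(** * Second moments of Lévy processes *)

Section moments.
Context {R : realType} {disp : measure_display} {T : measurableType disp}.
Variable P : probability T R.
Implicit Types X Y U V : T -> R.

Definition mfun_of d' (T' : measurableType d') (f : T -> T')
  (mf : measurable_fun setT f) : {mfun T >-> T'} :=
  HB.pack f (isMeasurableFun.Build _ _ _ _ f mf).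

(* If both the positive and the negative part had infinite integral, the integral
   would be +oo - +oo = -oo, not 0. *)
Lemma integrable_of_integral0 X : measurable_fun setT X ->
  (\int[P]_w (X w)%:E = 0)%E -> P.-integrable setT (EFin \o X).
Proof.
move=> mX; rewrite integralE => X0.
have mE : measurable_fun setT (EFin \o X) by exact/measurable_EFinP.
apply/integrableP; split => //.
have -> : (\int[P]_w `|(EFin \o X) w| =
   \int[P]_w ((EFin \o X)^\+ w + (EFin \o X)^\- w))%E.
  by apply: eq_integral => w _; rewrite -[LHS]/((abse \o (EFin \o X)) w) fune_abse.
rewrite ge0_integralD//; [|exact: measurable_funepos|exact: measurable_funeneg].
have p0 : (0 <= \int[P]_w (EFin \o X)^\+ w)%E by exact: integral_ge0.
have n0 : (0 <= \int[P]_w (EFin \o X)^\- w)%E by exact: integral_ge0.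
move: X0 p0 n0 => /=.
move: (\int[P]_w _)%E (\int[P]_w _)%E => [r||] [s||] //= _ _ _.
by rewrite -EFinD ltry.
Qed.

Definition independent_pair X Y := forall A B : set R, measurable A ->
  measurable B -> (P (X @^-1` A `&` Y @^-1` B) = P (X @^-1` A) * P (Y @^-1` B))%E.

(** Independence says that the joint law agrees with the product law on rectangles, hence
    everywhere; Tonelli's theorem splits the integral. *)
Lemma ge0_integral_independent X Y (h : R * R -> \bar R)
    (mX : measurable_fun setT X) (mY : measurable_fun setT Y) :
  independent_pair X Y -> measurable_fun setT h -> (forall z, (0 <= h z)%E) ->
  (\int[P]_w h (X w, Y w) =
   \int[distribution P (mfun_of mX)]_x
     \int[distribution P (mfun_of mY)]_y h (x, y))%E.
Proof.
move=> XY mh h0.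
pose mZ := measurable_fun_pair mX mY.
rewrite -[LHS](@ge0_integral_distribution _ _ _ _ _ P (mfun_of mZ) h)//.
rewrite -(@fubini_tonelli1 _ _ _ _ _ (distribution P (mfun_of mX))
  (distribution P (mfun_of mY)))//.
apply: eq_measure_integral => A mA _; apply/esym.
by apply: product_measure_unique => // B C mB mC; rewrite -[RHS]XY.
Qed.

Section second_moment_sum.
Variables (X Y : T -> R) (mX : measurable_fun setT X) (mY : measurable_fun setT Y).
Hypotheses (XY : independent_pair X Y) (Y0 : (\int[P]_w (Y w)%:E = 0)%E).

Let nu := distribution P (mfun_of mY).

Let integral_sqrD : (\int[P]_w ((X w + Y w) ^+ 2)%:E =
  \int[distribution P (mfun_of mX)]_x \int[nu]_y ((x + y) ^+ 2)%:E)%E.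
Proof.
rewrite (ge0_integral_independent mX mY (h := fun z => ((z.1 + z.2) ^+ 2)%:E))//.
  apply/measurable_EFinP; apply: measurable_funX.
  by apply: measurable_funD.
by move=> z; rewrite lee_fin sqr_ge0.
Qed.

(** Used with c = x^2 and k = 2x: the part of (x + y)^2 affine in y, whose linear term vanishes
    because Y has mean zero. *)
Let integrable_affine (c k : R) : nu.-integrable setT (fun y : R => (c + k * y)%:E) /\
  (\int[nu]_y (c + k * y)%:E = c%:E)%E.
Proof.
have mid : measurable_fun setT (EFin : R -> \bar R) by exact/measurable_EFinP.
have iY := integrable_of_integral0 mY Y0.
have iid : nu.-integrable setT (EFin : R -> \bar R).
  by apply: (@integrable_pushforward _ _ _ _ _ (mfun_of mY)) => //.
have id0 : (\int[nu]_y y%:E = 0)%E.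
  by rewrite (integral_distribution (X := mfun_of mY)).
have ic : nu.-integrable setT (EFin \o cst c : R -> \bar R).
  exact: finite_measure_integrable_cst.
have ik : nu.-integrable setT (fun y : R => (k%:E * y%:E)%E).
  exact: integrableZl.
split; first by apply: eq_integrable (integrableD _ ic ik).
under eq_integral do rewrite EFinD EFinM.
rewrite (integralD _ ic ik)// (integralZl _ iid)//.
rewrite id0 mule0 adde0.
have nuT : nu setT = 1%E by exact: probability_setT.
transitivity (c%:E * nu setT)%E; last by rewrite nuT mule1.
exact: (integral_cst nu measurableT c%:E).
Qed.

(* (x + y)^2 >= x^2 + 2xy, whose integral in y is x^2; this needs no integrability
   of the squares. *)
Lemma le_second_moment_sum :
  (\int[P]_w (X w ^+ 2)%:E <= \int[P]_w ((X w + Y w) ^+ 2)%:E)%E.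
Proof.
rewrite integral_sqrD.
have msq : measurable_fun setT (fun x : R => (x ^+ 2)%:E).
  by apply/measurable_EFinP; exact: measurable_funX.
rewrite -[leLHS](@ge0_integral_distribution _ _ _ _ _ P (mfun_of mX)
  (fun x => (x ^+ 2)%:E))//; last by move=> y; rewrite lee_fin sqr_ge0.
apply: ge0_le_integral => //.
- by move=> x _; rewrite lee_fin sqr_ge0.
- apply: (@measurable_fun_fubini_tonelli_F _ _ _ _ _ nu
    (fun z : R * R => ((z.1 + z.2) ^+ 2)%:E)).
    by apply/measurable_EFinP; apply: measurable_funX; exact: measurable_funD.
  by move=> z; rewrite lee_fin sqr_ge0.
move=> x _.
(* An infinite inner integral dominates anything; a finite one makes the square integrable, so that
   the two integrals may be compared. *)
have [|fin] := eqVneq (\int[nu]_y ((x + y) ^+ 2)%:E)%E +oo%E.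
  by move=> ->; rewrite leey.
have [ia ea] := integrable_affine (x ^+ 2) (2 * x).
rewrite -[leLHS]ea; apply: le_integral => //.
  apply/integrableP; split.
    by apply/measurable_EFinP; apply: measurable_funX; exact: measurable_funD.
  rewrite ltey; apply: contra_neq fin => <-.
  by apply: eq_integral => y _; rewrite abse_EFin ger0_norm// sqr_ge0.
move=> y _; rewrite lee_fin -subr_ge0.
have -> : (x + y) ^+ 2 - (x ^+ 2 + 2 * x * y) = y ^+ 2 by ring.
exact: sqr_ge0.
Qed.

Lemma second_moment_sum_le : (\int[P]_w (Y w ^+ 2)%:E < +oo)%E ->
  (\int[P]_w ((X w + Y w) ^+ 2)%:E <=
   \int[P]_w (X w ^+ 2)%:E + \int[P]_w (Y w ^+ 2)%:E)%E.
Proof.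
move=> Y2; rewrite integral_sqrD.
have msq : measurable_fun setT (fun x : R => (x ^+ 2)%:E).
  by apply/measurable_EFinP; exact: measurable_funX.
have sq0 (x : R) : (0 <= (x ^+ 2)%:E)%E by rewrite lee_fin sqr_ge0.
have EY : (\int[nu]_y (y ^+ 2)%:E = \int[P]_w (Y w ^+ 2)%:E)%E.
  exact: (@ge0_integral_distribution _ _ _ _ _ P (mfun_of mY)).
have isq : nu.-integrable setT (fun y : R => (y ^+ 2)%:E).
  apply/integrableP; split=> //; apply: le_lt_trans Y2; rewrite -EY.
  by rewrite le_eqVlt; apply/orP; left; apply/eqP; apply: eq_integral => y _; rewrite gee0_abs.
have inner (x : R) : (\int[nu]_y ((x + y) ^+ 2)%:E =
    (x ^+ 2)%:E + \int[P]_w (Y w ^+ 2)%:E)%E.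
  have [ia ea] := integrable_affine (x ^+ 2) (2 * x).
  rewrite -[X in (X + _)%E]ea -EY -integralD//.
  by apply: eq_integral => y _; rewrite -EFinD; congr EFin; ring.
under eq_integral do rewrite inner.
rewrite ge0_integralD//; last by move=> x _; apply: integral_ge0 => y _; exact: sq0.
have -> : (\int[distribution P (mfun_of mX)]_x
    (\int[P]_w (Y w ^+ 2)%:E) = \int[P]_w (Y w ^+ 2)%:E)%E.
  have muT : distribution P (mfun_of mX) setT = 1%E by exact: probability_setT.
  by rewrite -[RHS]mule1 -muT; exact: integral_cst.
by rewrite (@ge0_integral_distribution _ _ _ _ _ P (mfun_of mX) (fun x => (x ^+ 2)%:E)).
Qed.
End second_moment_sum.

Lemma ge0_eq_integral_law X Y (f : R -> \bar R) :
  measurable_fun setT X -> measurable_fun setT Y ->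
  (forall B, measurable B -> P (X @^-1` B) = P (Y @^-1` B)) ->
  measurable_fun setT f -> (forall x, (0 <= f x)%E) ->
  (\int[P]_w f (X w) = \int[P]_w f (Y w))%E.
Proof.
move=> mX mY XY mf f0.
rewrite -[LHS](@ge0_integral_distribution _ _ _ _ _ P (mfun_of mX) f)//.
rewrite -[RHS](@ge0_integral_distribution _ _ _ _ _ P (mfun_of mY) f)//.
by apply: eq_measure_integral => A mA _; exact: XY.
Qed.

Lemma tail_le_second_moment X x : measurable_fun setT X -> 0 < x ->
  ((x ^+ 2)%:E * P [set w | x <= `|X w|]%R <= \int[P]_w (X w ^+ 2)%:E)%E.
Proof.
move=> mX x0.
have := @markov _ _ _ P (mfun_of mX) (fun r => r ^+ 2) x x0.
have -> : ('E_P[(((fun r : R => (r ^+ 2)%R) \o [eta Num.Def.normr]) \o mfun_of mX)]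
    = \int[P]_w (X w ^+ 2)%:E)%E.
  by rewrite unlock; apply: eq_integral => w _ /=; rewrite real_normK// num_real.
apply.
- exact: measurable_funX.
- by move=> r _; exact: sqr_ge0.
- by move=> r s /[!nnegrE] r0 s0 rs; rewrite lerXn2r.
Qed.
End moments.

Section levy_moments.
Context {R : realType} {disp : measure_display} {T : measurableType disp}.
Variable P : probability T R.
Implicit Type X : R -> {RV P >-> R}.

Lemma measurable_increment X s t : measurable_fun setT (fun w => X t w - X s w).
Proof. by apply: measurable_funB. Qed.

Lemma levy_increment_law X (s t : R) (f : R -> \bar R) : levy_process X ->
  0 <= s -> s <= t -> measurable_fun setT f -> (forall x, (0 <= f x)%E) ->
  (\int[P]_w f (X t w - X s w)%R = \int[P]_w f (X (t - s)%R w))%E.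
Proof.
move=> [_ _ stat _ _] s0 st mf f0.
apply: ge0_eq_integral_law => //; first exact: measurable_increment.
by move=> B mB; exact: stat.
Qed.

Lemma levy_independent_increments X s t : levy_process X -> 0 < s -> s < t ->
  independent_pair P (fun w => X s w - X 0 w) (fun w => X t w - X s w).
Proof.
move=> [_ ind _ _ _] s0 st A B mA mB.
(* The independence axiom takes an infinite strictly increasing sequence of times: 0, s, t is
   prolonged by t + 1, t + 2 and so on. *)
pose tt (n : nat) : R :=
  match n with 0%N => 0 | 1%N => s | n.+2 => t + n%:R end.
pose BB (i : 'I_2) : set R := if i == ord0 then A else B.
have := ind 2%N tt (lexx 0) _ BB _.
rewrite big_ord_recl big_ord1 /tt /BB /= addr0 => <-; first last.
- by move=> i; rewrite /BB; case: ifP.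
- case=> [|[|n]] //=; first by rewrite addr0.
  by rewrite ltrD2l ltr_nat.
congr (P _); apply/seteqP; split=> w /=.
  by move=> [wA wB] [[|[|//]] i2] _ /=; rewrite ?addr0.
move=> H; split; first exact: (H ord0).
by have := H (lift ord0 ord0) I; rewrite /= addr0.
Qed.

(** The second moment [v] is nondecreasing by [le_second_moment_sum] and grows by at most [v 1] per
    unit of time by [second_moment_sum_le]; a real t is compared with the integer n + 1 above it. *)
Lemma levy_second_moment X n (t : R) : levy_process X ->
  (forall s, 0 <= s -> (\int[P]_w (X s w)%:E = 0)%E) ->
  (\int[P]_w (X 1 w ^+ 2)%:E < +oo)%E -> 0 <= t <= n.+1%:R ->
  (\int[P]_w (X t w ^+ 2)%:E <= n.+1%:R%:E * \int[P]_w (X 1 w ^+ 2)%:E)%E.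
Proof.
move=> LX X0 X1 /andP[t0 tn].
pose v t := (\int[P]_w (X t w ^+ 2)%:E)%E.
have msq : measurable_fun setT (fun x : R => (x ^+ 2)%:E).
  by apply/measurable_EFinP; exact: measurable_funX.
have sq0 (x : R) : (0 <= (x ^+ 2)%:E)%E by rewrite lee_fin sqr_ge0.
have iX t' : 0 <= t' -> P.-integrable setT (EFin \o X t').
  by move=> ?; apply: integrable_of_integral0 => //; exact: X0.
have incr0 s' t' : 0 <= s' -> 0 <= t' -> (\int[P]_w (X t' w - X s' w)%:E = 0)%E.
  move=> s0 t0'; under eq_integral do rewrite EFinB.
  by rewrite integralB_EFin ?iX// !X0// sube0.
have vE (s' t' : R) : 0 <= s' -> s' <= t' ->
    (\int[P]_w ((X t' w - X s' w) ^+ 2)%:E = v (t' - s')%R)%E.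
  by move=> ? ?; rewrite (@levy_increment_law X s' t' (fun x => (x ^+ 2)%:E)).
have sumE s' t' : (\int[P]_w ((X s' w - X 0 w + (X t' w - X s' w)) ^+ 2)%:E =
    \int[P]_w ((X t' w - X 0 w) ^+ 2)%:E)%E.
  by apply: eq_integral => w _; congr (_ ^+ 2)%:E; ring.
have mono s' t' : 0 < s' -> s' < t' -> (v s' <= v t')%E.
  move=> s0 st; have st0 := lt_trans s0 st.
  have := @le_second_moment_sum _ _ _ P _ _ (measurable_increment X 0 s')
    (measurable_increment X s' t') (levy_independent_increments LX s0 st)
    (incr0 _ _ (ltW s0) (ltW st0)).
  by rewrite sumE !vE ?subr0// ltW.
have sub s' t' : 0 < s' -> s' < t' -> (v (t' - s')%R < +oo)%E ->
    (v t' <= v s' + v (t' - s')%R)%E.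
  move=> s0 st fin; have st0 := lt_trans s0 st.
  have := @second_moment_sum_le _ _ _ P _ _ (measurable_increment X 0 s')
    (measurable_increment X s' t') (levy_independent_increments LX s0 st)
    (incr0 _ _ (ltW s0) (ltW st0)).
  rewrite sumE !vE ?subr0//; [|exact: ltW..].
  exact.
have vn : (v n.+1%:R%R <= (n.+1%:R)%:E * v 1%R)%E.
  elim: n {t0 tn} => [|n IH]; first by rewrite mul1e.
  have := sub n.+1%:R n.+2%:R.
  have -> : n.+2%:R - n.+1%:R = 1 :> R by rewrite -[n.+2%:R]natr1 addrAC subrr add0r.
  rewrite ltr0n ltr_nat ltnS leqnn => /(_ isT isT X1) /le_trans; apply.
  rewrite -[n.+2%:R]natr1 EFinD ge0_muleDl ?lee_fin// mul1e.
  exact: leeD2r.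
(* Monotonicity was obtained for positive times only; at 0 the process vanishes almost surely. *)
move: t0; rewrite le_eqVlt => /predU1P[<-|t0].
  have -> : (\int[P]_w (X 0 w ^+ 2)%:E = 0)%E.
    have [start _ _ _ _] := LX.
    transitivity (\int[P]_w (cst 0%E : T -> \bar R) w)%E; last by rewrite integral0.
    apply: ae_eq_integral => //.
      by apply/measurable_EFinP; apply: measurable_funX.
    by apply: filterS start => w /= -> _; rewrite expr0n.
  by rewrite mule_ge0 ?lee_fin//; exact: integral_ge0.
apply: le_trans vn.
by move: tn; rewrite le_eqVlt => /predU1P[->//|tn]; exact: mono.
Qed.
End levy_moments.

(** * Ottaviani's inequality *)

Section maximal_inequality.
Context {R : realType} {disp : measure_display} {T : measurableType disp}.
Variable P : probability T R.
Implicit Types (X : R -> {RV P >-> R}) (t : nat -> R).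

(** Joint events of the first [k] increments, not events of single ones: stability under
    intersection is what uniqueness of measures requires. *)
Definition increment_events X t (k : nat) : set (set T) :=
  [set A | exists2 B : nat -> set R, (forall i, measurable (B i)) &
     A = \bigcap_(i in `I_k) ((fun w => X (t i.+1) w - X (t i) w) @^-1` B i)].

Lemma increment_events_measurable X t k A : increment_events X t k A -> measurable A.
Proof.
move=> [B mB ->]; apply: bigcap_measurableType => i _.
by rewrite -[X in measurable X]setTI; apply: measurable_increment.
Qed.

(** As functions of [A], both sides are finite measures agreeing on the pi-system
    [increment_events X t k], hence on the sigma-algebra it generates. *)
Lemma levy_past_independent X t k A B : levy_process X -> 0 <= t 0%N ->
  (forall i, t i < t i.+1) -> <<s increment_events X t k >> A -> measurable B ->
  let D := (fun w => X (t k.+1) w - X (t k) w) @^-1` B in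
  (P (A `&` D) = P D * P A)%E.
Proof.
move=> [_ ind _ _ _] t0 tS sA mB D.
have mD : measurable D.
  by rewrite -[X in measurable X]setTI; apply: measurable_increment.
have pD : P D = (fine (P D))%:E by rewrite fineK// fin_num_measure.
have pD0 : 0 <= fine (P D) by rewrite fine_ge0.
pose r : {nonneg R} := NngNum pD0.
suff key : mrestr P mD A = mscale r P A by rewrite {1}pD; exact: key.
apply: (@g_sigma_algebra_measure_unique _ R T (increment_events X t k)
  (@increment_events_measurable X t k) (fun=> setT)) sA => //.
- by move=> _; exists (fun=> setT) => //; apply/seteqP; split.
- by apply/seteqP; split=> // x _; exists 0%N.
- move=> _ _ [B1 mB1 ->] [B2 mB2 ->]; exists (fun i => B1 i `&` B2 i).
    by move=> i; exact: measurableI.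
  apply/seteqP; split=> [w [H1 H2] i ik|w H].
    by split; [exact: H1|exact: H2].
  by split=> i ik; have [] := H i ik.
- move=> _ [C mC ->].
  (* Prescribing [B] for the increment of index k turns [A] and [D] into one event of k + 1
     increments; its product formula is compared with that for k. *)
  pose C' i := if i == k then B else C i.
  have := ind k.+1 t t0 tS (fun i : 'I_k.+1 => C' i) _.
  have := ind k t t0 tS (fun i : 'I_k => C i) (fun i => mC i).
  have capE (n : nat) (F : nat -> set T) :
      \bigcap_(i in [set: 'I_n]) F i = \bigcap_(i in `I_n) F i.
    apply/seteqP; split=> w H i; last by move=> _; exact: (H i (ltn_ord i)).
    by move=> ni; exact: (H (Ordinal ni) I).
  pose D_ (F : nat -> set R) i := (fun w => X (t i.+1) w - X (t i) w) @^-1` F i.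
  rewrite (capE k (D_ C)) (capE k.+1 (D_ C')) => e1 e2.
  have {}e2 := e2 _.
  change (P (\bigcap_(i in `I_k) D_ C i `&` D) =
    (fine (P D))%:E * P (\bigcap_(i in `I_k) D_ C i))%E.
  rewrite -pD e1.
  have -> : \bigcap_(i in `I_k) D_ C i `&` D = \bigcap_(i in `I_k.+1) D_ C' i.
    apply/seteqP; split=> [w [H1 H2] i|w H].
      rewrite /= ltnS leq_eqVlt /D_ /C' => /predU1P[->|ik].
        by rewrite /= eqxx.
      by rewrite /= (ltn_eqF ik); exact: H1.
    split=> [i ik|].
      by have := H i (ltnW ik); rewrite /D_ /C' /= (ltn_eqF ik).
    by have := H k (leqnn _); rewrite /D_ /C' /= eqxx.
  rewrite e2; last by move=> i; rewrite /C'; case: ifP.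
  rewrite big_ord_recr/= muleC; congr (_ * _)%E.
    by congr (P _); apply/seteqP; split=> w; rewrite /C' /= eqxx.
  apply: eq_bigr => i _; congr (P _).
  by apply/seteqP; split=> w; rewrite /C' /= (ltn_eqF (ltn_ord i)).
- by rewrite /= /mrestr setTI -ge0_fin_numE// fin_num_measure.
Qed.

Lemma measurable_normr_ge (x : R) : measurable [set y : R | x <= `|y|].
Proof.
rewrite (_ : [set y : R | _] = setT `&` (fun y : R => `|y|) @^-1` `[x, +oo[%classic).
  by apply: normr_measurable => //; exact: measurable_itv.
by rewrite setTI; apply/seteqP; split=> y /=; rewrite in_itv/= andbT.
Qed.

Lemma past_increment X t j k (x : R) : (j <= k)%N ->
  <<s increment_events X t k >> [set w | x <= `|X (t j) w - X (t 0%N) w|].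
Proof.
move=> jk; pose G := increment_events X t k.
suff mj : measurable_fun (setT : set (g_sigma_algebraType G))
    (fun w => X (t j) w - X (t 0%N) w).
  have := mj measurableT _ (measurable_normr_ge x).
  by rewrite setTI.
elim: j jk => [_|j IH jk].
  rewrite (_ : (fun w => _) = cst 0); first exact: measurable_cst.
  by apply/funext => w; rewrite subrr.
rewrite (_ : (fun w => _) = (fun w => X (t j) w - X (t 0%N) w) \+
    (fun w => X (t j.+1) w - X (t j) w)); last first.
  by apply/funext => w /=; ring.
apply: (measurable_funD (IH (ltnW jk))).
move=> _ Y mY; apply: sub_sigma_algebra.
exists (fun i => if i == j then Y else setT); first by move=> i; case: ifP.
rewrite setTI; apply/seteqP; split=> w /=.
  by move=> Yw i _; case: eqVneq => [->|].
by move=> /(_ j jk); rewrite eqxx.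
Qed.

(* Decompose according to the first k with |X (t k) - X (t 0)| >= 2x: this event is
   independent of X (t n) - X (t k), which has size at least x unless
   |X (t n) - X (t 0)| >= x. *)
Lemma ottaviani X t n x p : levy_process X -> 0 <= t 0%N ->
  (forall i, t i < t i.+1) -> 0 < x ->
  (forall k, (k <= n)%N -> (P [set w | x <= `|X (t n) w - X (t k) w|]%R <= p%:E)%E) ->
  (P (\big[setU/set0]_(k < n.+1) [set w | (2 * x <= `|X (t k) w - X (t 0%N) w|)%R])
    <= (2 * p)%:E)%E.
Proof.
move=> LX t0 tS x0 Hp.
pose E k : set T := [set w | 2 * x <= `|X (t k) w - X (t 0%N) w|].
pose C k : set T := [set w | x <= `|X (t n) w - X (t k) w|].
have mabs s1 s2 (y : R) : measurable [set w | y <= `|X s1 w - X s2 w|].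
  have := measurable_increment X s2 s1 measurableT (measurable_normr_ge y).
  by rewrite setTI.
have mE k : measurable (E k) by exact: mabs.
have mC k : measurable (C k) by exact: mabs.
pose A := seqDU E.
have mA k : measurable (A k).
  by apply: measurableD => //; exact: bigsetU_measurable.
have tlt k j : (k < j)%N -> t k < t j.
  by move=> kj; apply: (homo_ltn lt_trans).
have p0 : 0 <= p by rewrite -lee_fin; exact: le_trans (measure_ge0 _ _) (Hp 0%N isT).
have indep k : (k < n)%N -> (P (A k `&` C k) <= p%:E * P (A k))%E.
  move=> kn.
  (* The grid [t] with the points strictly between [t k] and [t n] removed. *)
  pose tt i := if (i <= k)%N then t i else t n + (i - k.+1)%:R.
  have tt0 : tt 0%N = t 0%N by [].
  have ttS i : tt i < tt i.+1.
    rewrite /tt; have [ik|ki] := ltnP i k; first by rewrite (ltnW ik) tS.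
    move: ki; rewrite leq_eqVlt => /predU1P[<-|ki].
      by rewrite leqnn subnn addr0 tlt.
    by rewrite leqNgt ki/= ltrD2l ltr_nat subSn.
  have ttk : tt k = t k by rewrite /tt leqnn.
  have ttk1 : tt k.+1 = t n by rewrite /tt ltnn subnn addr0.
  have sA : <<s increment_events X tt k >> (A k).
    have sE j : (j <= k)%N -> <<s increment_events X tt k >> (E j).
      move=> jk; have := @past_increment X tt j k (2 * x) jk.
      by rewrite /tt jk.
    pose G := increment_events X tt k.
    have : measurable (A k : set (g_sigma_algebraType G)).
      apply: measurableD; first exact: sE.
      by apply: bigsetU_measurable => j _; apply: sE; exact: ltnW.
    exact.
  have := @levy_past_independent X tt k (A k) [set y | x <= `|y|] LX _ ttS sA _.
  rewrite /= ttk ttk1 => ->; [|by []|].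
    by rewrite lee_wpmul2r//; exact/Hp/ltnW.
  exact: measurable_normr_ge.
(* A first excess at k = n itself already implies [C 0], so only k < n has to be paired with a later
   increment. *)
have sub : \big[setU/set0]_(k < n.+1) E k `<=`
    C 0%N `|` \big[setU/set0]_(k < n) (A k `&` C k).
  rewrite bigsetU_seqDU big_ord_recr/= => w.
  move=> [|[En _]]; last by left; move: En; rewrite /E /C /=; lra.
  rewrite -(bigcup_mkord n A) => -[k /= kn Akw].
  have [h|h] := leP x `|X (t n) w - X (t 0%N) w|; first by left.
  right; rewrite -(bigcup_mkord n (fun k => A k `&` C k)); exists k => //; split=> //.
  case: Akw => Ekw _; move: Ekw; rewrite /E /C /= => Ekw.
  have : `|X (t k) w - X (t 0%N) w| <=
      `|X (t n) w - X (t 0%N) w| + `|X (t n) w - X (t k) w|.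
    have -> : X (t k) w - X (t 0%N) w =
      (X (t n) w - X (t 0%N) w) - (X (t n) w - X (t k) w) by ring.
    exact: ler_normB.
  lra.
apply: (@le_trans _ _ (P (C 0%N `|` \big[setU/set0]_(k < n) (A k `&` C k)))).
  apply: le_measure => //; rewrite inE.
    exact: bigsetU_measurable.
  by apply: measurableU => //; apply: bigsetU_measurable => k _; exact: measurableI.
apply: (le_trans (measureU2 _ _ _)) => //.
  by apply: bigsetU_measurable => k _; exact: measurableI.
(* One [p] bounds [C 0]; the other bounds the sum over k, the events [A k] being disjoint with total
   probability at most 1. *)
have -> : 2 * p = p + p by ring.
rewrite EFinD leeD//; first exact: Hp.
have B := @Boole_inequality _ _ _ P (fun k => A k `&` C k) n
  (fun k _ => measurableI _ _ (mA k) (mC k)).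
apply: (le_trans B).
apply: (@le_trans _ _ (\sum_(k < n) p%:E * P (A k))%E).
  by apply: lee_sum => k _; exact: indep.
rewrite -ge0_sume_distrr; last by move=> k _; exact: measure_ge0.
rewrite -[leRHS]mule1 lee_wpmul2l ?lee_fin//.
rewrite -(measure_bigsetU P mA (@trivIset_seqDU _ E) n).
by apply: probability_le1; apply: bigsetU_measurable.
Qed.
End maximal_inequality.

(** * Growth of Lévy paths *)

Section path_growth.
Context {R : realType} {disp : measure_display} {T : measurableType disp}.
Variable P : probability T R.
Implicit Types (X : R -> {RV P >-> R}).

(** Phrased through one-dimensional laws only, so that it passes to the second copy by equality in
    law, while the moment assumptions are read off the first copy. *)
Definition linear_tail X (V : R) := forall (n : nat) (t x : R),
  0 <= t <= n.+1%:R -> 0 < x ->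
  (P [set w | x <= `|X t w|]%R <= (n.+1%:R * V / x ^+ 2)%:E)%E.

Lemma levy_linear_tail X : levy_process X ->
  (forall t, 0 <= t -> (\int[P]_w (X t w)%:E = 0)%E) ->
  (\int[P]_w (X 1 w ^+ 2)%:E < +oo)%E ->
  linear_tail X (fine (\int[P]_w (X 1 w ^+ 2)%:E)%E).
Proof.
move=> LX X0 X1 n t x t0n x0.
have x2 : 0 < x ^+ 2 by rewrite exprn_gt0.
have v0 : (0 <= \int[P]_w (X 1 w ^+ 2)%:E)%E.
  by apply: integral_ge0 => w _; rewrite lee_fin sqr_ge0.
have mXt : measurable_fun setT (X t) by [].
have := le_trans (tail_le_second_moment P mXt x0) (levy_second_moment LX X0 X1 t0n).
rewrite -(@fineK _ (\int[P]_w (X 1 w ^+ 2)%:E)%E) ?ge0_fin_numE// -EFinM.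
have mA : measurable [set w | x <= `|X t w|].
  by have := mXt measurableT _ (measurable_normr_ge x); rewrite setTI.
rewrite -(@fineK _ (P [set w | x <= `|X t w|])) ?fin_num_measure//.
by rewrite -EFinM !lee_fin => h; rewrite ler_pdivlMr// mulrC.
Qed.

Lemma same_law_tail X Y V : same_law X Y -> linear_tail X V -> linear_tail Y V.
Proof.
move=> XY HX n t x t0n x0; have /andP[t0 _] := t0n.
have := XY 1%N (fun=> t) (fun=> [set y | x <= `|y|]) (fun=> t0)
  (fun=> measurable_normr_ge x).
have capE (F : set T) : \bigcap_(i in [set: 'I_1]) F = F.
  by apply/seteqP; split=> w; [move=> /(_ ord0 I)|move=> ? ? _].
by rewrite !capE => <-; exact: HX.
Qed.

Lemma levy_increment_tail X V n s t x : levy_process X -> linear_tail X V ->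
  0 <= s -> s <= t -> t <= n.+1%:R -> 0 < x ->
  (P [set w | x <= `|X t w - X s w|]%R <= (n.+1%:R * V / x ^+ 2)%:E)%E.
Proof.
move=> [_ _ stat _ _] HX s0 st tn x0.
rewrite (stat s t [set y | x <= `|y|] s0 st (measurable_normr_ge x)).
by apply: HX => //; lra.
Qed.

(** Here [k] fixes the horizon 2^k and [m] the fineness; the point of index j at level m has index
    2j at level m + 1, so the grids are nested. *)
Definition grid (k m j : nat) : R := j%:R * 2 ^+ k / 2 ^+ m.

Definition dyadic_excess X (x : R) (k m : nat) : set T :=
  \big[setU/set0]_(j < (2 ^ m).+1)
    [set w | 2 * x <= `|X (grid k m j) w - X 0 w|].

Lemma measurable_dyadic_excess X x k m : measurable (dyadic_excess X x k m).
Proof.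
apply: bigsetU_measurable => j _.
have := measurable_increment X 0 (grid k m j) measurableT (measurable_normr_ge (2 * x)).
by rewrite setTI.
Qed.

(** The bound does not depend on [m], which lets the grid become dense at a fixed horizon. *)
Lemma dyadic_excess_le X V x k m : levy_process X -> linear_tail X V -> 0 < x ->
  (P (dyadic_excess X x k m) <= (2 * (2 ^+ k * V / x ^+ 2))%:E)%E.
Proof.
move=> LX HX x0.
have e0 n : 0 < 2 ^+ n :> R by rewrite exprn_gt0.
have gS i : grid k m i < grid k m i.+1.
  by rewrite /grid ltr_pM2r ?invr_gt0// ltr_pM2r// ltr_nat.
have g0 : grid k m 0 = 0 by rewrite /grid !mul0r.
have gm j i : (j <= i)%N -> grid k m j <= grid k m i.
  by move=> ji; rewrite /grid ler_pM2r ?invr_gt0// ler_pM2r// ler_nat.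
have gT : grid k m (2 ^ m) = 2 ^+ k.
  by rewrite /grid natrX mulrAC divff ?mul1r// gt_eqF.
have E2 : 2 ^+ k = ((2 ^ k).-1).+1%:R :> R.
  by rewrite prednK ?expn_gt0// natrX.
rewrite E2.
have := @ottaviani _ _ _ P X (grid k m) (2 ^ m) x
  (((2 ^ k).-1).+1%:R * V / x ^+ 2) LX _ gS x0.
rewrite g0; apply=> // j jm.
apply: levy_increment_tail => //; last by rewrite gT E2.
  by rewrite -[leLHS]g0 gm.
exact: gm.
Qed.

Lemma dyadic_excess_nondecreasing X x k :
  nondecreasing_seq (dyadic_excess X x k).
Proof.
apply/nondecreasing_seqP => m; rewrite subsetEset /dyadic_excess.
rewrite -!(bigcup_mkord _ (fun j => [set w | 2 * x <= `|X (grid k _ j) w - X 0 w|])).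
move=> w [j /= jm H]; exists (2 * j)%N => /=.
  by move: jm; rewrite !ltnS expnS leq_pmul2l.
suff -> : grid k m.+1 (2 * j) = grid k m j by [].
have e0 n : 2 ^+ n != 0 :> R by rewrite expf_neq0.
rewrite /grid natrM exprS; field.
by rewrite e0.
Qed.

Lemma dyadic_excess_bigcup_le X V x k : levy_process X -> linear_tail X V -> 0 < x ->
  (P (\bigcup_m dyadic_excess X x k m) <= (2 * (2 ^+ k * V / x ^+ 2))%:E)%E.
Proof.
move=> LX HX x0.
have cv := @nondecreasing_cvg_mu _ _ _ P (dyadic_excess X x k)
  (measurable_dyadic_excess X x k) (bigcupT_measurable _ (measurable_dyadic_excess X x k))
  (@dyadic_excess_nondecreasing X x k).
rewrite -(cvg_lim _ cv)//; apply: lime_le; first by apply/cvg_ex; eexists; exact: cv.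
by apply: nearW => m /=; exact: dyadic_excess_le.
Qed.

Lemma geometric_nneseries_lty (u : nat -> \bar R) (A q : R) : 0 <= A -> 0 < q < 1 ->
  (forall k, (0 <= u k)%E) -> (forall k, (u k <= (A * q ^+ k)%:E)%E) ->
  (\sum_(k <oo) u k < +oo)%E.
Proof.
move=> A0 /andP[q0 q1] u0 uq.
have q10 : 0 < 1 - q by lra.
apply: (@le_lt_trans _ _ (A / (1 - q))%:E); last exact: ltry.
apply: lime_le; first by apply: is_cvg_nneseries => n _ _; exact: u0.
apply: nearW => n.
apply: (@le_trans _ _ (\sum_(0 <= k < n) (A * q ^+ k)%:E)%E).
  by apply: lee_sum => k _; exact: uq.
rewrite sumEFin lee_fin big_mkord -mulr_sumr ler_wpM2l// -[leRHS]mul1r ler_pdivlMr//.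
have := subrX1 q n; have : 0 <= q ^+ n by rewrite exprn_ge0// ltW.
by move: (\sum_(i < n) _) => S; nra.
Qed.

Lemma levy_eventually_small X V rho : levy_process X -> linear_tail X V -> 0 <= V ->
  0 < rho -> 2 < rho ^+ 2 ->
  {ae P, forall w, exists K, forall k, (K <= k)%N -> forall m j, (j <= 2 ^ m)%N ->
     `|X (grid k m j) w - X 0 w| < 2 * rho ^+ k}.
Proof.
move=> LX HX V0 r0 r2.
pose F k := \bigcup_m dyadic_excess X (rho ^+ k) k m.
have mF k : measurable (F k).
  by apply: bigcupT_measurable => m; exact: measurable_dyadic_excess.
have F0 : P (lim_sup_set F) = 0%E.
  apply: lim_sup_set_cvg0 => //.
  apply: (@geometric_nneseries_lty _ (2 * V) (2 / rho ^+ 2)).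
  - by rewrite mulr_ge0.
  - by rewrite divr_gt0 ?exprn_gt0//= ltr_pdivrMr ?exprn_gt0// mul1r.
  - by move=> k; exact: measure_ge0.
  - move=> k; apply: (le_trans (dyadic_excess_bigcup_le k LX HX _)).
      by rewrite exprn_gt0.
    rewrite lee_fin expr_div_n -!exprM mulnC le_eqVlt; apply/orP; left; apply/eqP.
    by ring.
exists (lim_sup_set F); split => //.
  by apply: bigcap_measurableType => n _; apply: bigcup_measurable => j _.
move=> w /= nH n _; apply: contrapT => nF; apply: nH; exists n => k nk m j jm.
rewrite ltNge; apply/negP => h; apply: nF; exists k => //; exists m => //.
rewrite /dyadic_excess
  -(bigcup_mkord _ (fun j => [set w | 2 * rho ^+ k <= `|X (grid k m j) w - X 0 w|])).
by exists j.
Qed.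

Lemma right_continuous_dyadic_bound (f : R -> R) (k : nat) (B t : R) :
  f s @[s --> t^'+] --> f t -> 0 <= t < 2 ^+ k ->
  (forall m j, (j <= 2 ^ m)%N -> `|f (grid k m j)| < B) -> `|f t| <= B.
Proof.
move=> ft /andP[t0 tk] H; rewrite leNgt; apply/negP => Bf.
have e0 : 0 < `|f t| - B by rewrite subr_gt0.
move/cvgrPdist_lt : ft => /(_ _ e0)/nbhs_ballP[r /= r0 Hr].
(* The level [m] below satisfies 2^m > m > 2^k / r, so the grid step is smaller than r. *)
have kp : 0 < 2 ^+ k :> R by rewrite exprn_gt0.
pose m := (Num.truncn (2 ^+ k / r)).+1.
have mp : 0 < 2 ^+ m :> R by rewrite exprn_gt0.
have mE : 2 ^+ m = (2 ^ m)%:R :> R by rewrite natrX.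
have mr : 2 ^+ k / 2 ^+ m < r.
  rewrite ltr_pdivrMr// mulrC -ltr_pdivrMr//.
  apply: (lt_le_trans (truncnS_gt _)).
  by rewrite mE ler_nat; exact/ltnW/ltn_expl.
pose y := t * 2 ^+ m / 2 ^+ k.
have y0 : 0 <= y by rewrite divr_ge0 ?mulr_ge0// ltW.
(* The first grid point strictly to the right of t, where right continuity applies; t < 2^k keeps it
   on the grid. *)
pose j := (Num.truncn y).+1.
have ym : y < (2 ^ m)%:R.
  by rewrite /y natrX ltr_pdivrMr// mulrC ltr_pM2l.
have jm : (j <= 2 ^ m)%N.
  by rewrite /j truncn_lt_nat.
have yj : y < j%:R by exact: truncnS_gt.
have jy : j%:R <= y + 1 by rewrite /j -natr1 lerD2r truncn_le.
have tE : t = y * 2 ^+ k / 2 ^+ m by rewrite /y; field; rewrite !gt_eqF.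
have tg : t < grid k m j.
  by rewrite tE /grid ltr_pM2r ?invr_gt0// ltr_pM2r.
have gt : grid k m j <= t + 2 ^+ k / 2 ^+ m.
  rewrite {1}tE -mulrDl -{2}[2 ^+ k]mul1r -mulrDl /grid ler_pM2r ?invr_gt0//.
  by rewrite ler_pM2r.
have := Hr (grid k m j); rewrite /ball/= => /(_ _ tg).
rewrite ltr_norml => /(_ ltac:(lra)).
have := H m j jm => h1 h2.
have := ler_normD (f t - f (grid k m j)) (f (grid k m j)).
rewrite subrK; lra.
Qed.

Lemma exists_dyadic_scale (x : R) : 1 <= x -> exists n, 2 ^+ n <= x < 2 ^+ n.+1.
Proof.
move=> x1; have x0 : 0 <= x by exact: le_trans x1.
have N0 : (0 < Num.truncn x)%N by rewrite truncn_gt0.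
exists (trunc_log 2 (Num.truncn x)); apply/andP; split.
  apply: (@le_trans _ _ (Num.truncn x)%:R); last by rewrite truncn_le.
  by rewrite -natrX ler_nat; exact: trunc_logP.
apply: (lt_le_trans (truncnS_gt x)); rewrite -natrX ler_nat.
exact: trunc_log_ltn.
Qed.

Lemma levy_path_growth X V b : levy_process X -> linear_tail X V -> 0 <= V ->
  2^-1 < b ->
  {ae P, forall w, exists C, 0 <= C /\ forall t, 0 <= t -> `|X t w| <= C * (1 + t) `^ b}.
Proof.
move=> LX HX V0 b2; pose rho : R := 2 `^ b.
have b0 : 0 < b by lra.
have r0 : 0 < rho by exact: powR_gt0.
have r2 : 2 < rho ^+ 2.
  rewrite -powR_mulrn ?ltW// /rho -powRrM -[X in X < _]powRr1//.
  by rewrite /powR pnatr_eq0/= ltr_expR ltr_pM2r ?ln_gt0 ?ltr1n//; lra.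
have [X0 _ _ _ Xc] := LX.
have rk n : rho ^+ n = (2 ^+ n) `^ b.
  by rewrite -powR_mulrn ?ltW// /rho powRAC powR_mulrn.
have := levy_eventually_small LX HX V0 r0 r2.
apply: filterS3 X0 Xc => w w0 [wc _] [K HK].
(* With 2^n <= 1 + t < 2^(n + 1), the bound is used at horizon n + 1 + K, large enough for every t;
   the extra K + 1 powers of [rho] go into the constant, and rho^n <= (1 + t)^b. *)
exists (2 * rho ^+ K.+1); split; first by rewrite mulr_ge0// exprn_ge0// ltW.
move=> t t0; have [|n /andP[n1 n2]] := @exists_dyadic_scale (1 + t); first by lra.
have tk : t < 2 ^+ (n.+1 + K).
  have : 2 ^+ n.+1 <= 2 ^+ (n.+1 + K) :> R by rewrite ler_weXn2l ?ler1n// leq_addr.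
  by lra.
have : `|X t w| <= 2 * rho ^+ (n.+1 + K).
  apply: (@right_continuous_dyadic_bound (X ^~ w) (n.+1 + K)) => //.
  - exact: wc.
  - by rewrite t0.
  - move=> m j jm; have := HK (n.+1 + K)%N (leq_addl _ _) m j jm.
    by rewrite w0 subr0.
move/le_trans; apply.
rewrite addSnnS addnC exprD mulrA ler_wpM2l//.
  by rewrite mulr_ge0// exprn_ge0// ltW.
rewrite rk; apply: ge0_ler_powR; rewrite ?nnegrE ?exprn_ge0//; lra.
Qed.
End path_growth.

(** * Gluing two one-sided paths into a path on the real line *)

Section two_sided_paths.
Context {R : realType}.
Implicit Types f : R -> R.

Lemma left_limit_dist f (a r c e : R) : cvg (f s @[s --> r^'-]) -> a < r ->
  (forall y, a < y < r -> `|f y - c| <= e) ->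
  `|lim (f s @[s --> r^'-]) - c| <= e.
Proof.
move=> fr ar H.
have cv : `|f s - c| @[s --> r^'-] --> `|lim (f s @[s --> r^'-]) - c|.
  by apply: cvg_norm; apply: cvgB => //; exact: cvg_cst.
rewrite -(cvg_lim _ cv)//; apply: limr_le; first by apply/cvg_ex; eexists; exact: cv.
near=> s; apply: H; apply/andP; split; near: s.
  exact: nbhs_left_gt.
exact: nbhs_left_lt.
Unshelve. all: by end_near. Qed.

(** Reflection exchanges the sides: a right limit of [f2] at -y becomes a left limit of [l] at y,
    and conversely. At negative times [l] is itself a left limit of [f2], through which closed
    bounds pass. At 0 the right side comes from [f1], the left one from [f2]. *)
Lemma two_sided_one_sided_limits f1 f2 (l : R -> R) : cadlag f1 -> cadlag f2 ->
  (forall s, 0 <= s -> l s = f1 s) ->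
  (forall s, s < 0 -> l s = lim (f2 r @[r --> (- s)^'-])) ->
  forall x, one_sided_limits l x.
Proof.
move=> [f1r f1l] [f2r f2l] l1 l2 x.
have negR (y c : R) : y <= 0 -> f2 s @[s --> (- y)^'+] --> c -> l s @[s --> y^'-] --> c.
  move=> y0 /cvgrPdist_le cv; apply/cvgrPdist_le => /= e e0.
  move/nbhs_ballP : (cv e e0) => [r /= r0 Hr].
  apply/nbhs_ballP; exists r => //= s; rewrite /ball/= ltr_norml => sr sy.
  rewrite l2; last by lra.
  rewrite distrC; apply: (@left_limit_dist _ (- y)); [by apply: f2l; lra|by lra|].
  move=> z zs; rewrite distrC; apply: Hr; last by lra.
  by rewrite /ball/= ltr_norml; lra.
have negL (y c : R) : y < 0 -> f2 s @[s --> (- y)^'-] --> c -> l s @[s --> y^'+] --> c.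
  move=> y0 /cvgrPdist_le cv; apply/cvgrPdist_le => /= e e0.
  move/nbhs_ballP : (cv e e0) => [r /= r0 Hr].
  (* The radius -y keeps [s] negative, so that [l s] is still given by [f2]. *)
  apply/nbhs_ballP; exists (Num.min r (- y)) => /=; first by rewrite lt_min r0; lra.
  move=> s; rewrite /ball/= lt_min !ltr_norml => /andP[sr sy'] sy.
  rewrite l2; last by lra.
  rewrite distrC; apply: (@left_limit_dist _ (Num.max 0 (- y - r))).
  - by apply: f2l; lra.
  - by rewrite gt_max; lra.
  - move=> z; rewrite gt_max => /andP[/andP[z0 zr] zs]; rewrite distrC; apply: Hr; last by lra.
    by rewrite /ball/= ltr_norml; lra.
have [x0|x0] := ltP x 0.
  split; apply/cvg_ex.
    have /cvg_ex[c cv] := f2l (- x) ltac:(lra).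
    by exists c; exact: negL.
  by exists (f2 (- x)); apply: negR; [exact: ltW|apply: f2r; lra].
split; apply/cvg_ex.
  exists (f1 x); apply: cvg_trans (f1r x x0); apply: near_eq_cvg.
  near=> s; rewrite l1//; apply: (le_trans x0); apply: ltW; near: s.
  exact: nbhs_right_gt.
have [xp|x0'] := ltP 0 x.
  have /cvg_ex[c cv] := f1l x xp; exists c.
  apply: cvg_trans cv; apply: near_eq_cvg.
  near=> s; rewrite l1//; apply: ltW; near: s; exact: nbhs_left_gt.
exists (f2 (- x)); apply: negR => //; apply: f2r; lra.
Unshelve. all: by end_near. Qed.

Lemma two_sided_growth f1 f2 (l : R -> R) (b C1 C2 : R) : 0 < b -> cadlag f2 ->
  (forall s, 0 <= s -> l s = f1 s) ->
  (forall s, s < 0 -> l s = lim (f2 r @[r --> (- s)^'-])) ->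
  0 <= C1 -> (forall t, 0 <= t -> `|f1 t| <= C1 * (1 + t) `^ b) ->
  0 <= C2 -> (forall t, 0 <= t -> `|f2 t| <= C2 * (1 + t) `^ b) ->
  forall s, `|l s| <= (C1 + C2) * (1 + `|s|) `^ b.
Proof.
move=> b0 [_ f2l] l1 l2 C10 H1 C20 H2 s.
have [s0|s0] := leP 0 s.
  rewrite l1// (le_trans (H1 s s0))// ger0_norm// ler_wpM2r ?powR_ge0//; lra.
rewrite l2// -[lim _]subr0; apply: (@left_limit_dist _ 0); [by apply: f2l; lra|by lra|].
move=> y /andP[y0 ys]; rewrite subr0 (le_trans (H2 y (ltW y0)))//.
rewrite ltr0_norm//; apply: ler_pM; [by []|exact: powR_ge0|by lra|].
by apply: ge0_ler_powR; rewrite ?nnegrE; lra.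
Qed.
End two_sided_paths.

Unset Implicit Arguments.

Theorem lemma3p2 (R : realType) (disp : measure_display)
    (T : measurableType disp) (P : probability T R) (L : R -> T -> R)
    (d lambda : R) (a : \bar R) :
  measure_is_complete P ->
  FLP_driver P L ->
  0 < d < 2^-1 ->
  0 < lambda ->
  (a < +oo)%E ->
  {ae P, forall w,
    let Ld := fun s : R => FLP d L s w in
    let E := fun s : R => expR (lambda * s) in
    [/\ a = -oo%E -> E r * Ld r @[r --> -oo] --> 0,
        (forall t : R, (a < t%:E)%E ->
          [/\ RS_integrable E Ld a t,
              RS_integrable (fun s => Ld s * E s) id a t &
              RS_integral E Ld a t =
                E t * Ld t
                - (match a with r%:E => E r * Ld r | _ => 0 end)
                - lambda * RS_integral (fun s => Ld s * E s) id a t]) &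
        {in [set t : R | (a < t%:E)%E],
          continuous (fun t => RS_integral E Ld a t)}]}.
Proof.
move=> _ [[L1 [L2 [LX1 LX2 law12 _ LE]]] mean0 sq _] /andP[d0 d2] l0 ay.
have L1E t : 0 <= t -> L t = L1 t by move=> t0; rewrite LE /two_sided t0.
have mean1 t : 0 <= t -> (\int[P]_w (L1 t w)%:E = 0)%E.
  by move=> t0; have := mean0 t; rewrite unlock L1E.
have sq1 : (\int[P]_w (L1 1 w ^+ 2)%:E < +oo)%E by move: sq; rewrite unlock L1E.
have tail1 := levy_linear_tail LX1 mean1 sq1.
have tail2 := same_law_tail law12 tail1.
(* The midpoint of ]1/2, 1 - d[. *)
pose b : R := 3 / 4 - d / 2.
have [b2 bd] : 2^-1 < b /\ b < 1 - d by rewrite /b; split; lra.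
have V0 : 0 <= fine (\int[P]_w (L1 1 w ^+ 2)%:E)%E.
  by rewrite fine_ge0//; apply: integral_ge0 => w _; rewrite lee_fin sqr_ge0.
have growth1 := levy_path_growth LX1 tail1 V0 b2.
have growth2 := levy_path_growth LX2 tail2 V0 b2.
have cadlag1 := levy_cadlag LX1; have cadlag2 := levy_cadlag LX2.
(* None of these four almost sure events depends on t, so one null set serves all t > a. *)
apply: filterS (filterI (filterI growth1 growth2) (filterI cadlag1 cadlag2)).
move=> w [[[C1 [C10 H1]] [C2 [C20 H2]]] [c1 c2]].
pose l : R -> R := L ^~ w.
have l1 s : 0 <= s -> l s = L1 s w by move=> s0; rewrite /l L1E.
have l2 s : s < 0 -> l s = lim (L2 r w @[r --> (- s)^'-]).
  by move=> s0; rewrite /l LE /two_sided leNgt s0.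
have tl : tame_path d b (C1 + C2) l.
  split; [lra|lra|by []|exact: addr_ge0|split].
    exact: (two_sided_one_sided_limits c1 c2 l1 l2).
  by apply: (two_sided_growth _ c2 l1 l2 C10 H1 C20 H2); lra.
have FE : (fun s => FLP d L s w) = (fun s => (Gamma d)^-1 * FLP_integral d l s).
  by apply/funext => s; exact: (FLP_integralE s tl).
have [K K0 HK] := FLP_integral_growth tl.
apply: (@RS_expR_continuous_path R lambda (`|(Gamma d)^-1| * K)) => //.
  rewrite FE => x; apply: cvgM; first exact: cvg_cst.
  exact: FLP_integral_continuous tl x.
move=> s s0; rewrite (FLP_integralE s tl erefl) normrM -mulrA ler_wpM2l//.
exact: HK.
Qed.
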